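(* The following conditions are equivalent for the $\zeta$-function $\zeta_M(t)$ of a locally finite module $M$ over $\mathfrak{G} = \mathrm{Gal}(\overline{\mathbb{F}_q}/\mathbb{F}_q)$: (i) $P_M(t) := \frac{\zeta_M(t)}{\zeta_{\mathbb{P}^1(\overline{\mathbb{F}_q})}(t)} \in \mathbb{Z}[t]$ is a polynomial of degree $\deg P_M(t) = d \leq \delta \in \mathbb{N}$; (ii) $M$ satisfies the Generic Riemann-Roch Conditions $$\mathcal{A}_n(M) = -q^{n+1}\,\mathrm{Res}_{\frac1q}(\zeta_M(t)) - \mathrm{Res}_1(\zeta_M(t)) = \frac{q^{n+1}P_M\left(\frac1q\right) - P_M(1)}{q-1}$$ (where, by the definition of the Generic Riemann-Roch Conditions, the equality is required for all sufficiently large natural numbers $n \geq n_o$); (iii) $$\left|\mathbb{P}^1(\overline{\mathbb{F}_q})^{\Phi_q^r}\right| - \left|M^{\Phi_q^r}\right| = \sum_{j=1}^d \omega_j^r \quad \text{for all } r \in \mathbb{N}$$ and some $\omega_j \in \mathbb{C}^*$, which turn out to be the reciprocals of the roots of $P_M(t) = \prod_{j=1}^d (1 - \omega_j t)$.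
   Context: $\mathbb{F}_q$ is a finite field, $\Phi_q(a)=a^q$ is the Frobenius automorphism of $\overline{\mathbb{F}_q}$, and $\mathfrak{G} = \mathrm{Gal}(\overline{\mathbb{F}_q}/\mathbb{F}_q)$ is the profinite completion of the infinite cyclic group $\langle\Phi_q\rangle$. A $\mathfrak{G}$-module is a set with an action of $\mathfrak{G}$; it is locally finite if all $\mathfrak{G}$-orbits are finite and for every $n\in\mathbb{N}$ there are at most finitely many $\mathfrak{G}$-orbits of cardinality $n$. The degree $\deg\nu$ of an orbit $\nu$ is its cardinality. The $\zeta$-function of $M$ is the formal power series $\zeta_M(t)=\prod_\nu\frac{1}{1-t^{\deg\nu}}$, the product being over all $\mathfrak{G}$-orbits $\nu$ on $M$; for the projective line, $\zeta_{\mathbb{P}^1(\overline{\mathbb{F}_q})}(t)=\frac{1}{(1-t)(1-qt)}$. For $r \in \mathbb{N}$, $M^{\Phi_q^r}=\{x\in M : \Phi_q^r(x)=x\}$ is the set of $\Phi_q^r$-rational points of $M$, and similarly for $\mathbb{P}^1(\overline{\mathbb{F}_q})$. Divisors on $M$ are the elements $D=\sum_\nu a_\nu\nu$ of the free abelian group generated by the $\mathfrak{G}$-orbits of $M$; $D$ is effective if all its non-zero coefficients are positive; $\deg D=\sum_\nu a_\nu\deg\nu$; $\mathcal{A}_n(M)$ is the (finite) number of effective divisors on $M$ of degree $n$. $\mathrm{Res}_a(\zeta_M(t))$ is the residue of $\zeta_M(t)$ at $t=a$. A locally finite $\mathfrak{G}$-module $M$ is said to satisfy the Generic Riemann-Roch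 Conditions if $\mathcal{A}_n(M) = -q^{n+1}\,\mathrm{Res}_{\frac1q}(\zeta_M(t)) - \mathrm{Res}_1(\zeta_M(t))$ for all sufficiently large natural numbers $n \geq n_o$. *)

(* Defs.v *)
From HB Require Import structures.
From mathcomp Require Import all_boot all_order all_algebra finfield mxpoly.
From mathcomp Require Import finmap.
From mathcomp Require Import all_classical all_reals all_analysis.
From mathcomp.real_closed Require Import complex.
From mathcomp.multinomials Require Import freeg.
Set Implicit Arguments.
Unset Strict Implicit.
Unset Printing Implicit Defensive.
Import Order.TTheory GRing.Theory Num.Theory.
Import numFieldNormedType.Exports.

Local Open Scope classical_set_scope.
Local Open Scope ring_scope.

Section FormalPowerSeries.

Record fps (R : Type) := FPS { fps_coef : nat -> R }.

Lemma fpsP (R : Type) (a b : fps R) : fps_coef a =1 fps_coef b -> a = b.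
Proof. by case: a b => [a] [b] /= /funext ->. Qed.

HB.instance Definition _ (R : Type) := gen_eqMixin (fps R).
HB.instance Definition _ (R : Type) := gen_choiceMixin (fps R).

Variable R : comUnitRingType.
Implicit Types a b c : fps R.

Definition fps_zero : fps R := FPS (fun=> 0).
Definition fps_opp a : fps R := FPS (fun n => - fps_coef a n).
Definition fps_add a b : fps R := FPS (fun n => fps_coef a n + fps_coef b n).

Fact fps_addA : associative fps_add.
Proof. by move=> a b c; apply: fpsP => n /=; rewrite addrA. Qed.
Fact fps_addC : commutative fps_add.
Proof. by move=> a b; apply: fpsP => n /=; rewrite addrC. Qed.
Fact fps_add0 : left_id fps_zero fps_add.
Proof. by move=> a; apply: fpsP => n /=; rewrite add0r. Qed.
Fact fps_addN : left_inverse fps_zero fps_opp fps_add.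
Proof. by move=> a; apply: fpsP => n /=; rewrite addNr. Qed.

HB.instance Definition _ :=
  GRing.isZmodule.Build (fps R) fps_addA fps_addC fps_add0 fps_addN.

Definition fps_one : fps R := FPS (fun n => (n == 0)%:R).
Definition fps_mul a b : fps R :=
  FPS (fun n => \sum_(i < n.+1) fps_coef a i * fps_coef b (n - i)%N).

Definition fps_trunc m a : {poly R} := \poly_(i < m.+1) fps_coef a i.

Lemma fps_mul_trunc m n a b : (n <= m)%N ->
  fps_coef (fps_mul a b) n = (fps_trunc m a * fps_trunc m b)`_n.
Proof.
move=> nm; rewrite coefM /=; apply: eq_bigr => i _.
rewrite !coef_poly !ltnS (leq_trans _ nm) 1?(leq_trans _ nm) ?leq_subr //.
by rewrite -ltnS.
Qed.

Lemma fps_coef_trunc m n a : (n <= m)%N -> (fps_trunc m a)`_n = fps_coef a n.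
Proof. by move=> nm; rewrite coef_poly ltnS nm. Qed.

Fact fps_mulA : associative fps_mul.
Proof.
move=> a b c; apply: fpsP => n.
transitivity ((fps_trunc n a * fps_trunc n b * fps_trunc n c)`_n).
  rewrite -mulrA coefM; apply: eq_bigr => i _.
  have ni : (i <= n)%N by rewrite -ltnS.
  by rewrite fps_coef_trunc // (fps_mul_trunc _ _ (leq_subr i n)).
rewrite coefM /=; apply: eq_bigr => i _.
have ni : (i <= n)%N by rewrite -ltnS.
by rewrite fps_coef_trunc ?leq_subr // -(fps_mul_trunc a b ni).
Qed.

Fact fps_mulC : commutative fps_mul.
Proof.
by move=> a b; apply: fpsP => n; rewrite !(fps_mul_trunc _ _ (leqnn n)) mulrC.
Qed.

Fact fps_mul1 : left_id fps_one fps_mul.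
Proof.
move=> a; apply: fpsP => n /=; rewrite big_ord_recl /= mul1r subn0.
by rewrite big1 ?addr0 // => i _; rewrite mul0r.
Qed.

Fact fps_mulDl : left_distributive fps_mul fps_add.
Proof.
move=> a b c; apply: fpsP => n /=; rewrite -big_split /=.
by apply: eq_bigr => i _; rewrite mulrDl.
Qed.

Fact fps_one_neq0 : fps_one != 0.
Proof.
apply/eqP => /(congr1 (fun a => fps_coef a 0)) /= /eqP.
by rewrite oner_eq0.
Qed.

HB.instance Definition _ := GRing.Zmodule_isComNzRing.Build (fps R)
  fps_mulA fps_mulC fps_mul1 fps_mulDl fps_one_neq0.

Definition fps_const (x : R) : fps R := FPS (fun n => if n is 0 then x else 0).

Lemma fps_coef_constM x a n : fps_coef (fps_const x * a) n = x * fps_coef a n.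
Proof.
rewrite [LHS]big_ord_recl /= subn0 big1 ?addr0 // => i _.
by rewrite mul0r.
Qed.

Lemma fps_coefM0 a b : fps_coef (a * b) 0 = fps_coef a 0 * fps_coef b 0.
Proof. by rewrite [LHS]big_ord1. Qed.

Lemma fps_coefD a b n : fps_coef (a + b) n = fps_coef a n + fps_coef b n.
Proof. by []. Qed.

Lemma fps_coefN a n : fps_coef (- a) n = - fps_coef a n.
Proof. by []. Qed.

Lemma fps_coef_sum (I : Type) (r : seq I) (f : I -> fps R) n :
  fps_coef (\sum_(i <- r) f i) n = \sum_(i <- r) fps_coef (f i) n.
Proof.
by apply: (big_morph (fun a => fps_coef a n)) => // a b; rewrite fps_coefD.
Qed.

Lemma fps_exp_coef0 a k n :
  fps_coef a 0 = 0 -> (n < k)%N -> fps_coef (a ^+ k) n = 0.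
Proof.
move=> a0; elim: k n => // k IHk n; rewrite ltnS => nk.
rewrite exprS [LHS]big_ord_recl /= a0 mul0r add0r big1 // => i _.
rewrite IHk ?mulr0 //; apply: leq_trans nk; rewrite /bump /= add1n.
by have := ltn_ord i; case: (n) i => [|m] [j]//= _ _; rewrite subSS ltnS leq_subr.
Qed.

(* If the constant coefficient [v^-1] of [a] is invertible, then               *)
(* [a^-1 = v * sum_k (1 - v * a)^k].                                           *)
Definition fps_unit : pred (fps R) := fun a => fps_coef a 0 \is a GRing.unit.
Definition fps_inv a : fps R :=
  if fps_unit a then
    let v := (fps_coef a 0)^-1 in
    FPS (fun n =>
      v * \sum_(k < n.+1) fps_coef ((1 - fps_const v * a) ^+ k) n)
  else a.

Fact fps_mulV : {in fps_unit, left_inverse 1 fps_inv *%R}.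
Proof.
move=> a ua; have ua1 : fps_unit a = true by exact: ua.
rewrite /fps_inv ua1.
set v := (fps_coef a 0)^-1; set u := 1 - fps_const v * a.
have u0 : fps_coef u 0 = 0.
  rewrite fps_coefD fps_coefN fps_coef_constM /v mulVr ?subrr //; exact: ua.
set b := FPS _; apply: fpsP => n.
pose s := \sum_(k < n.+1) u ^+ k.
have bs i : (i <= n)%N -> fps_coef b i = fps_coef (fps_const v * s) i.
  move=> ni; rewrite fps_coef_constM /b /s /= fps_coef_sum; congr (_ * _).
  rewrite -!(big_mkord xpredT (fun k => fps_coef (u ^+ k) i)).
  rewrite [RHS](big_cat_nat (n := i.+1)) //=.
  rewrite [X in _ + X]big_nat_cond [X in _ + X]big1 ?addr0 // => k.
  by case/andP => /andP[ik _] _; apply: fps_exp_coef0.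
have -> : fps_coef (b * a) n = fps_coef (fps_const v * s * a) n.
  by apply: eq_bigr => i _; rewrite bs // -ltnS.
have -> : fps_const v * s * a = (1 - u) * s.
  by rewrite /u opprB addrC subrK -mulrA (mulrC s) mulrA.
have -> : (1 - u) * s = 1 - u ^+ n.+1.
  by rewrite -[in RHS](expr1n _ n.+1) subrXX; congr (_ * _);
    apply: eq_bigr => i _; rewrite expr1n mul1r.
by rewrite fps_coefD fps_coefN fps_exp_coef0 // subr0.
Qed.

Fact fps_unitPl a b : b * a = 1 -> fps_unit a.
Proof.
move=> /(congr1 (fun c => fps_coef c 0)); rewrite fps_coefM0 => ba.
by apply/unitrPr; exists (fps_coef b 0); rewrite mulrC.
Qed.

Fact fps_inv_out : {in [predC fps_unit], fps_inv =1 id}.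
Proof. by move=> a /negbTE ua; rewrite /fps_inv [fps_unit a]ua. Qed.

HB.instance Definition _ := GRing.ComNzRing_hasMulInverse.Build (fps R)
  fps_mulV fps_unitPl fps_inv_out.

Definition poly_fps (p : {poly R}) : fps R := FPS (fun n => p`_n).

End FormalPowerSeries.

Section GSets.

Record gset (G : groupType) := GSet {
  gcarrier :> Type;
  gact : G -> gcarrier -> gcarrier;
  gact1 : forall x, gact 1%g x = x;
  gactM : forall g h x, gact (g * h)%g x = gact g (gact h x)
}.

(* Cardinality of a finite set; the value on infinite sets is meaningless.    *)
Definition ncard (T : Type) (A : set T) : nat :=
  (#|` fset_set (A : set {classic T})|)%fset.

Variables (G : groupType) (M : gset G).

Definition gorbit (x : M) : set M := range (fun g : G => gact g x).
Definition gorbits : set (set M) := range gorbit.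

Definition locally_finite : Prop :=
  (forall nu, gorbits nu -> finite_set nu) /\
  (forall n, finite_set [set nu | gorbits nu /\ ncard nu = n]).

(* The coefficient of [t^n] in the product of [1 / (1 - t^(deg nu))] over all *)
(* orbits only depends on the finitely many orbits of degree at most [n].     *)
Definition zeta : fps int := FPS (fun n => fps_coef
  (\big[*%R/(1 : fps int)]_(nu \in [set nu | gorbits nu /\ (ncard nu <= n)%N])
     (poly_fps (1 - 'X^(ncard nu)))^-1) n).

Definition fixed_points (g : G) : set M := [set x | gact g x = x].

Definition divisor := {freeg gorbits / int}.
Definition div_effective (D : divisor) : Prop :=
  forall nu : gorbits, coeff nu D != 0 -> 0 < coeff nu D.
Definition div_deg (D : divisor) : int :=
  \sum_(nu <- dom D) coeff nu D * (ncard (val nu))%:Z.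
Definition num_effective (n : nat) : nat :=
  ncard [set D : divisor | div_effective D /\ div_deg D = n%:Z].

End GSets.

Arguments fixed_points {G} M g.
Arguments num_effective {G} M n.

Section AbsoluteGaloisGroup.

Variables (F : finFieldType) (Fbar : closedFieldType).
Variable iota : {rmorphism F -> Fbar}.

Record absGal := AbsGal {
  gal_fun :> {rmorphism Fbar -> Fbar};
  gal_bij : bijective gal_fun;
  gal_fix : forall a, gal_fun (iota a) = iota a
}.

Lemma absGalP (g h : absGal) : (g : Fbar -> Fbar) =1 h -> g = h.
Proof.
case: g h => [g bg fg] [h bh fh] /= /funext gh.
have {}gh : g = h.
  case: g h gh {bg fg bh fh} => g [ag mg] [h [ah mh]] /= gh.
  move: ag mg ah mh; rewrite gh => ag mg ah mh.
  case: ag mg ah mh => ag [mg] [ah] [mh].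
  by rewrite (Prop_irrelevance ag ah) (Prop_irrelevance mg mh).
move: bg fg bh fh; rewrite gh => bg fg bh fh.
by rewrite (Prop_irrelevance bg bh) (Prop_irrelevance fg fh).
Qed.

HB.instance Definition _ := gen_eqMixin absGal.
HB.instance Definition _ := gen_choiceMixin absGal.

Definition gal_one : absGal :=
  @AbsGal (idfun : {rmorphism Fbar -> Fbar})
    (inv_bij (fun=> erefl)) (fun=> erefl).

Fact gal_mul_fix (g h : absGal) a : (g \o h) (iota a) = iota a.
Proof. by rewrite /= !gal_fix. Qed.

Definition gal_mul (g h : absGal) : absGal :=
  @AbsGal (gal_fun g \o gal_fun h) (bij_comp (gal_bij g) (gal_bij h))
    (gal_mul_fix g h).

Fact gal_inv_ex (g : absGal) : exists h : absGal, cancel g h /\ cancel h g.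
Proof.
have [f gK fK] := gal_bij g.
have fD : zmod_morphism f.
  by move=> x y; apply: (can_inj gK); rewrite rmorphB !fK.
have fM : monoid_morphism f.
  split; first by apply: (can_inj gK); rewrite rmorph1 fK.
  by move=> x y; apply: (can_inj gK); rewrite rmorphM !fK.
pose fa := GRing.isZmodMorphism.Build _ _ f fD.
pose fm := GRing.isMonoidMorphism.Build _ _ f fM.
pose fr : {rmorphism Fbar -> Fbar} := HB.pack f fa fm.
have fix_f a : fr (iota a) = iota a.
  by rewrite -[in LHS](gal_fix g) /= gK.
by exists (@AbsGal fr (Bijective fK gK) fix_f).
Qed.

Definition gal_inv (g : absGal) : absGal := sval (cid (gal_inv_ex g)).

Fact gal_mulA : associative gal_mul.
Proof. by move=> f g h; apply: absGalP. Qed.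
Fact gal_mul1 : left_id gal_one gal_mul.
Proof. by move=> g; apply: absGalP. Qed.
Fact gal_mulg1 : right_id gal_one gal_mul.
Proof. by move=> g; apply: absGalP. Qed.
Fact gal_mulV : left_inverse gal_one gal_inv gal_mul.
Proof.
move=> g; apply: absGalP => x /=; rewrite /gal_inv.
by case: cid => h [/= gK _]; rewrite gK.
Qed.
Fact gal_mulVr : right_inverse gal_one gal_inv gal_mul.
Proof.
move=> g; apply: absGalP => x /=; rewrite /gal_inv.
by case: cid => h [/= _ hK]; rewrite hK.
Qed.

HB.instance Definition _ := isGroup.Build absGal
  gal_mulA gal_mul1 gal_mulg1 gal_mulV gal_mulVr.

Definition Frobenius_fun (x : Fbar) : Fbar := x ^+ #|F|.

Fact Frobenius_pnat : [pchar Fbar].-nat #|F|.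
Proof.
have [p p_pr pF] := finPcharP F.
have := card_pprimeChar pF; rewrite -/(pPrimeCharType pF) => ->.
by rewrite pnatX pnatE // (rmorph_pchar iota pF).
Qed.

Fact Frobenius_zmod : zmod_morphism Frobenius_fun.
Proof.
move=> x y; rewrite /Frobenius_fun exprDn_pchar ?Frobenius_pnat //.
by rewrite exprNn_pchar ?Frobenius_pnat.
Qed.

Fact Frobenius_monoid : monoid_morphism Frobenius_fun.
Proof. by split=> [|x y]; rewrite /Frobenius_fun ?expr1n ?exprMn. Qed.

HB.instance Definition _ :=
  GRing.isZmodMorphism.Build Fbar Fbar Frobenius_fun Frobenius_zmod.
HB.instance Definition _ :=
  GRing.isMonoidMorphism.Build Fbar Fbar Frobenius_fun Frobenius_monoid.

Fact Frobenius_bij : bijective Frobenius_fun.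
Proof.
have inj : injective Frobenius_fun := fmorph_inj Frobenius_fun.
have sur y : exists x, Frobenius_fun x = y.
  have q_gt0 : (0 < #|F|)%N by apply/card_gt0P; exists 0.
  have [x] := solve_monicpoly (fun i => if i == 0%N then y else 0) q_gt0.
  move=> xE; exists x; rewrite /Frobenius_fun xE (bigD1 (Ordinal q_gt0)) //=.
  rewrite mulr1 big1 ?addr0 // => i; rewrite -val_eqE /= => /negPf ->.
  by rewrite mul0r.
pose f y := sval (cid (sur y)).
have fK : cancel f Frobenius_fun by move=> y; rewrite /f; case: cid.
by exists f => // x; apply: inj; rewrite fK.
Qed.

Fact Frobenius_fix a : Frobenius_fun (iota a) = iota a.
Proof. by rewrite /Frobenius_fun -rmorphXn expf_card. Qed.

Definition Frobenius : absGal :=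
  @AbsGal (Frobenius_fun : {rmorphism Fbar -> Fbar})
    Frobenius_bij Frobenius_fix.

(* [Some x] is the point [x : 1] and [None] is the point [1 : 0].             *)
Definition P1_act (g : absGal) : option Fbar -> option Fbar := omap g.

Fact P1_act1 x : P1_act 1%g x = x.
Proof. by case: x. Qed.
Fact P1_actM g h x : P1_act (g * h)%g x = P1_act g (P1_act h x).
Proof. by case: x. Qed.

Definition P1 : gset absGal := GSet P1_act1 P1_actM.

End AbsoluteGaloisGroup.

Section Residues.

Variable C : numClosedFieldType.
Implicit Types (F h : C -> C) (a b r : C).

(* [F] is meromorphic at [b] with residue [r]: near [b] it is the sum of a    *)
(* holomorphic function and of a principal part [sum_k c_k / (z - b)^(k+1)]   *)
(* with [c_0 = r].                                                            *)
Definition meromorphic_residue F b r : Prop :=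
  exists (m : nat) (c : nat -> C) h,
    [/\ c 0%N = r,
        \forall z \near b, derivable (h : C^o -> C^o) z 1 &
        \forall z \near b^',
          F z = \sum_(k < m.+1) c k / (z - b) ^+ k.+1 + h z].

(* The residue at [a] of the formal power series [f] is that of its           *)
(* meromorphic continuation to an open disc centred at [0] and containing     *)
(* [a]. By the identity theorem there is at most one such [r].                *)
Definition fps_residue (f : fps int) a r : Prop :=
  exists (rho : C) F,
    [/\ `|a| < rho,
        forall b, `|b| < rho -> exists s, meromorphic_residue F b s,
        \forall z \near (0 : C),
          series (fun n => (fps_coef f n)%:~R * z ^+ n) n @[n --> \oo] --> F z &
        meromorphic_residue F a r].

Definition generic_RR_from (G : groupType) (M : gset G) (q r1 r2 : C)
    (n0 : nat) : Prop :=
  [/\ fps_residue (zeta M) q^-1 r1, fps_residue (zeta M) 1 r2 &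
      forall n, (n0 <= n)%N ->
        (num_effective M n)%:R = - q ^+ n.+1 * r1 - r2].

Definition generic_RR (G : groupType) (M : gset G) (q : C) : Prop :=
  exists r1 r2 n0, generic_RR_from M q r1 r2 n0.

End Residues.

(* Main.v *)
Require Import Defs.
From HB Require Import structures.
From mathcomp Require Import all_boot all_order all_algebra finfield mxpoly cyclic separable.
From mathcomp Require Import finmap ring.
From mathcomp Require Import all_classical all_reals all_analysis.
From mathcomp.real_closed Require Import complex.
From mathcomp.multinomials Require Import freeg.
Set Implicit Arguments.
Unset Strict Implicit.
Unset Printing Implicit Defensive.
Import Order.TTheory GRing.Theory Num.Theory.
Local Open Scope ring_scope.

(** Write [q] for the order of the finite field, [theta = t d/dt] for the Euler
    derivation of formal power series and [N_r(M)] for the number of points of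
    [M] fixed by the [r]-th power of the Frobenius.  Everything rests on two
    readings of the coefficients of [zeta M].

    _Rational points._ Every element of the Galois group is, modulo [N]-th
    powers, a power of the Frobenius ([gal_decomp]); since an [N!]-th power acts
    trivially on a set of [N] points, a finite orbit of the abstract group is a
    single cycle of the Frobenius ([gorbit_degP]).  Hence [N_r(M)]
    is the sum of the degrees of the orbits whose degree divides [r], which says
    that [theta (zeta M) = zeta M * sum_(r >= 1) N_r(M) t^r]
    ([fps_theta_zeta]).  In characteristic zero such an equation, together with
    the constant term, determines the series ([fps_theta_uniq]).  Applied to the
    projective line, where [N_r = q^r + 1], it gives
    [zeta P1 = 1 / ((1 - t) (1 - q t))]; applied to
    [P = zeta M / zeta P1 = (1 - t) (1 - q t) zeta M] it shows that
    [N_r(P1) - N_r(M) = sum_j omega_j^r] for all [r >= 1] if and only if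
    [P = prod_j (1 - omega_j t)], because the product satisfies
    [theta Q = - Q * sum_(r >= 1) (sum_j omega_j^r) t^r].  A polynomial with
    constant term [1] over the complex numbers always has this shape, which makes
    (i) and (iii) equivalent.

    _Effective divisors._ Expanding the Euler product, the [n]-th coefficient of
    [zeta M] is the number of effective divisors of degree [n]
    ([num_effectiveE]).  If this number is [- q^(n+1) r1 - r2] for [n >= n0], then
    multiplying by [(1 - t) (1 - q t)] kills all coefficients of index at least
    [n0 + 2], and [P] is a polynomial.  Conversely, if [P] is a polynomial, the
    partial fraction decomposition of [P / ((1 - t) (1 - q t))] provides both the
    meromorphic continuation of [zeta M], with its two residues, and the formula
    for its coefficients beyond the polynomial part.  Finally the values of
    [r1] and [r2] can be recovered from the numbers of divisors, since
    [a q^n + b] at two consecutive [n] determines [a] and [b]; this yields the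
    explicit expression in terms of [P (1/q)] and [P 1]. *)

(** * Logarithmic derivatives of formal power series *)

Section FormalLogarithmicDerivative.
Variable R : comUnitRingType.
Implicit Types (a b l : fps R) (p : {poly R}).

Definition fps_geom (x : R) : fps R := FPS (fun n => x ^+ n).
Definition fps_theta a : fps R := FPS (fun n => fps_coef a n *+ n).
(** The geometric series [1 / (1 - t^d)], see [fps_multiplesP]. *)
Definition fps_multiples d : fps R := FPS (fun n => (d %| n)%N%:R).

Lemma fps_coefM a b n :
  fps_coef (a * b) n = \sum_(i < n.+1) fps_coef a i * fps_coef b (n - i)%N.
Proof. by []. Qed.

Lemma fps_coef1 n : fps_coef (1 : fps R) n = (n == 0)%N%:R.
Proof. by []. Qed.

Lemma fps_coefMn a k n : fps_coef (a *+ k) n = fps_coef a n *+ k.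
Proof. by elim: k => // k IH; rewrite !mulrS -IH. Qed.

Lemma poly_fpsM p r : poly_fps (p * r) = poly_fps p * poly_fps r.
Proof. by apply: fpsP => n; rewrite fps_coefM /= coefM. Qed.

Lemma poly_fpsD p r : poly_fps (p + r) = poly_fps p + poly_fps r.
Proof. by apply: fpsP => n /=; rewrite coefD. Qed.

Lemma poly_fpsN p : poly_fps (- p) = - poly_fps p.
Proof. by apply: fpsP => n /=; rewrite coefN. Qed.

Lemma poly_fps1 : poly_fps (1 : {poly R}) = 1.
Proof. by apply: fpsP => n; rewrite /= coef1. Qed.

Lemma poly_fps_inj : injective (@poly_fps R).
Proof. by move=> p r e; apply/polyP => i; have /(congr1 (@fps_coef R ^~ i)) := e. Qed.

Lemma fps_unitE a : (a \is a GRing.unit) = (fps_coef a 0 \is a GRing.unit).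
Proof. by []. Qed.

Lemma fps_coefXnM d a n :
  fps_coef (poly_fps 'X^d * a) n = if (n < d)%N then 0 else fps_coef a (n - d).
Proof.
rewrite fps_coefM /=; case: ltnP => [nd|dn].
  rewrite big1 // => i _; rewrite coefXn.
  have /negPf -> : (i != d :> nat)%N by rewrite ltn_eqF // (leq_trans (ltn_ord i)).
  by rewrite mul0r.
have dn1 : (d < n.+1)%N by [].
rewrite (bigD1 (Ordinal dn1)) //= coefXn eqxx mul1r big1 ?addr0 // => i.
by rewrite -val_eqE /= coefXn => /negPf ->; rewrite mul0r.
Qed.

Lemma fps_multiplesP d : (0 < d)%N ->
  poly_fps (1 - 'X^d) * fps_multiples d = 1.
Proof.
move=> d0; apply: fpsP => n.
rewrite poly_fpsD poly_fpsN poly_fps1 mulrDl mul1r mulNr fps_coefD fps_coefN.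
rewrite fps_coefXnM /=; case: ltnP => nd.
  rewrite subr0; case: n nd => [|n] nd /=; first by rewrite dvdn0.
  by rewrite gtnNdvd.
have -> : (n == 0)%N = false by apply/negbTE; rewrite -lt0n (leq_trans d0).
by rewrite -{1}(subnK nd) dvdn_addl // subrr.
Qed.

Lemma fps_geomP x : poly_fps (1 - x *: 'X) * fps_geom x = 1.
Proof.
apply: fpsP => n; rewrite poly_fpsD poly_fpsN poly_fps1 mulrDl mul1r mulNr.
rewrite fps_coefD fps_coefN.
have -> : poly_fps (x *: 'X) = fps_const x * poly_fps 'X^1.
  by apply: fpsP => k; rewrite fps_coef_constM /= coefZ expr1.
rewrite -mulrA fps_coef_constM fps_coefXnM /=; case: n => [|n] /=.
  by rewrite mulr0 subr0.
by rewrite subn1 /= -exprS subrr.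
Qed.

Lemma fps_coef_linearM x a n :
  fps_coef (poly_fps (1 - x *: 'X) * a) n.+1 = fps_coef a n.+1 - x * fps_coef a n.
Proof.
have -> : poly_fps (1 - x *: 'X) = 1 - fps_const x * poly_fps 'X^1.
  apply: fpsP => k; rewrite fps_coefD fps_coefN fps_coef_constM /=.
  by rewrite coefD coefN coefZ coef1 expr1.
rewrite mulrDl mul1r mulNr fps_coefD fps_coefN -mulrA.
by rewrite fps_coef_constM fps_coefXnM /= subn1.
Qed.

Lemma poly_fps_trunc a n :
  (forall i, (n <= i)%N -> fps_coef a i = 0) -> a = poly_fps (\poly_(i < n) fps_coef a i).
Proof.
by move=> a0; apply: fpsP => i /=; rewrite coef_poly; case: ltnP => // /a0.
Qed.

Lemma fps_thetaM a b : fps_theta (a * b) = fps_theta a * b + a * fps_theta b.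
Proof.
apply: fpsP => n; rewrite fps_coefD !fps_coefM /= -sumrMnl -big_split /=.
apply: eq_bigr => i _; rewrite mulrnAl mulrnAr -mulrnDr subnKC //.
by rewrite -ltnS.
Qed.

Lemma fps_theta1 : fps_theta 1 = 0.
Proof. by apply: fpsP => -[|n] //=; rewrite mul0rn. Qed.

(** Inverting a series changes the sign of its logarithmic derivative [- l]. *)
Lemma fps_theta_inv a b l :
  a * b = 1 -> fps_theta a = - (a * l) -> fps_theta b = b * l.
Proof.
move=> ab ta; have := congr1 fps_theta ab.
rewrite fps_thetaM fps_theta1 ta => /(congr1 (fun c => b * c)).
rewrite mulr0 mulrDr mulNr mulrAC ab mul1r mulrN mulrCA mulrA ab mul1r.
by rewrite addrC => /eqP; rewrite subr_eq0 => /eqP.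
Qed.

(** The logarithmic derivative of [1 / (1 - t^d)] is [d (t^d + t^(2d) + ...)]: this is
    how an orbit of degree [d] contributes [d] points fixed by the [r]-th power of the
    Frobenius exactly when [d] divides [r]. *)
Lemma fps_theta_multiples d : (0 < d)%N ->
  fps_theta (fps_multiples d) = fps_multiples d * ((fps_multiples d - 1) *+ d).
Proof.
move=> d0; apply: (fps_theta_inv (fps_multiplesP d0)).
rewrite mulrnAr mulrBr mulr1 fps_multiplesP //; apply: fpsP => n.
rewrite poly_fpsD poly_fpsN poly_fps1 subKr.
rewrite fps_coefN fps_coefMn.
change (((n == 0)%N%:R - ('X^d : {poly R})`_n) *+ n = - (('X^d : {poly R})`_n *+ d)).
rewrite coefXn.
case: eqVneq => [->|_] /=; first by rewrite (ltn_eqF d0) /= mul0rn oppr0.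
by rewrite sub0r mulNrn; case: (eqVneq n d) => [->|_] //; rewrite !mul0rn.
Qed.

(** The logarithmic derivative of [1 - x t] is [- (x t + x^2 t^2 + ...)], the power sums
    of the single reciprocal root [x]. *)
Lemma fps_theta_linear x :
  fps_theta (poly_fps (1 - x *: 'X)) = poly_fps (1 - x *: 'X) * (1 - fps_geom x).
Proof.
rewrite mulrBr mulr1 fps_geomP; apply: fpsP => n.
rewrite fps_coefD fps_coefN /= coefD coef1 coefN coefZ coefX.
case: n => [|[|n]] /=; rewrite ?mulr0 ?mulr1 ?subr0 ?sub0r ?mulr0n ?subrr //.
by rewrite mul0rn.
Qed.

Lemma fps_theta_prod (I : Type) (s : seq I) (a l : I -> fps R) :
  (forall i, fps_theta (a i) = a i * l i) ->
  fps_theta (\prod_(i <- s) a i) = (\prod_(i <- s) a i) * \sum_(i <- s) l i.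
Proof.
move=> al; elim: s => [|i s IH]; first by rewrite !big_nil mulr0 fps_theta1.
by rewrite !big_cons fps_thetaM IH al mulrDr mulrAC -!mulrA.
Qed.

Definition fps_eq1_upto n a := forall i, (i <= n)%N -> fps_coef a i = (i == 0)%N%:R.

Lemma fps_coefM_eq1_upto n a b :
  fps_eq1_upto n b -> fps_coef (a * b) n = fps_coef a n.
Proof.
move=> b1; rewrite fps_coefM big_ord_recr /= subnn b1 // mulr1 big1 ?add0r // => i _.
rewrite b1 ?leq_subr // subn_eq0 leqNgt ltn_ord mulr0 //.
Qed.

Lemma fps_eq1_upto_prod n (I : Type) (s : seq I) (P : pred I) (a : I -> fps R) :
  (forall i, P i -> fps_eq1_upto n (a i)) -> fps_eq1_upto n (\prod_(i <- s | P i) a i).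
Proof.
move=> a1; elim/big_rec: _ => [|i b Pi b1] // k kn.
rewrite fps_coefM_eq1_upto ?a1 // => j jk; apply: b1; exact: leq_trans kn.
Qed.

End FormalLogarithmicDerivative.

Section Uniqueness.
Variable R : numDomainType.
Implicit Types (a b l : fps R).

(** The coefficient equation [n a_n = a_(n-1) l_1 + ... + a_0 l_n] determines [a_n] from
    the previous coefficients as soon as [n] is cancellable. *)
Lemma fps_theta_uniq a b l : fps_coef l 0 = 0 ->
  fps_coef a 0 = fps_coef b 0 ->
  fps_theta a = a * l -> fps_theta b = b * l -> a = b.
Proof.
move=> l0 ab0 ta tb; apply: fpsP => n; elim/ltn_ind: n => -[|n] IH //.
have step c : fps_theta c = c * l ->
    fps_coef c n.+1 *+ n.+1 = \sum_(i < n.+1) fps_coef c i * fps_coef l (n.+1 - i)%N.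
  move=> /(congr1 (@fps_coef R ^~ n.+1)) /= ->.
  by rewrite big_ord_recr /= subnn l0 mulr0 addr0.
apply: (@pmulrnI _ n.+1) => //; rewrite !step //.
by apply: eq_bigr => i _; rewrite IH.
Qed.

End Uniqueness.

Section Map.
Variables (A B : comUnitRingType) (f : {rmorphism A -> B}).
Definition fps_map (a : fps A) : fps B := FPS (fun n => f (fps_coef a n)).

Lemma fps_mapM a b : fps_map (a * b) = fps_map a * fps_map b.
Proof.
by apply: fpsP => n; rewrite /= rmorph_sum; apply: eq_bigr => i _; rewrite rmorphM.
Qed.
Lemma fps_map_theta a : fps_map (fps_theta a) = fps_theta (fps_map a).
Proof. by apply: fpsP => n; rewrite /= rmorphMn. Qed.
Lemma fps_map_poly p : fps_map (poly_fps p) = poly_fps (map_poly f p).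
Proof. by apply: fpsP => n; rewrite /= coef_map. Qed.
End Map.

(** * The Frobenius topologically generates the Galois group *)

Section Galois.
Variables (F : finFieldType) (Fbar : closedFieldType).
Variable iota : {rmorphism F -> Fbar}.
Hypothesis Fbar_algebraic : integralRange iota.
Local Notation q := #|F|.
Implicit Types (x y : Fbar) (g h : absGal iota).

Definition frob (i : nat) x : Fbar := x ^+ (q ^ i).

Lemma card_finField_gt1 : (1 < q)%N.
Proof. exact: finNzRing_gt1. Qed.

Lemma frob0 x : frob 0 x = x. Proof. by rewrite /frob expn0 expr1. Qed.

Lemma frobD i j x : frob (i + j) x = frob i (frob j x).
Proof. by rewrite /frob -exprM expnD mulnC. Qed.

Lemma Frobenius_expE r x : (Frobenius iota ^+ r)%g x = frob r x.
Proof.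
elim: r => [|r IH]; first by rewrite expg0 frob0.
rewrite expgS; change (Frobenius_fun F ((Frobenius iota ^+ r)%g x) = frob r.+1 x).
by rewrite IH -add1n frobD /frob expn1.
Qed.

Lemma frob_inj i : injective (frob i).
Proof.
by move=> x y; rewrite -!Frobenius_expE => /fmorph_inj.
Qed.

Lemma frob_gal g i x : g (frob i x) = frob i (g x).
Proof. by rewrite /frob rmorphXn. Qed.

Lemma frobM i x y : frob i (x * y) = frob i x * frob i y.
Proof. exact: exprMn. Qed.

Lemma frobB i x y : frob i (x - y) = frob i x - frob i y.
Proof. by rewrite -!Frobenius_expE rmorphB. Qed.

Lemma frob1 i : frob i 1 = 1. Proof. exact: expr1n. Qed.

Lemma frob_iota i a : frob i (iota a) = iota a.
Proof. by rewrite -Frobenius_expE gal_fix. Qed.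

Lemma frob_iter m k x : frob m x = x -> frob (k * m) x = x.
Proof. by move=> mx; elim: k => [|k IH]; rewrite ?frob0 // mulSn frobD IH. Qed.

Lemma frob_dvd m n x : (m %| n)%N -> frob m x = x -> frob n x = x.
Proof. by case/dvdnP => k -> /frob_iter. Qed.

Lemma frob_modn m a x : frob m x = x -> frob (a %% m) x = frob a x.
Proof. by move=> mx; rewrite [in RHS](divn_eq a m) addnC frobD frob_iter. Qed.

Lemma frob_eqmod m a b x : frob m x = x -> a = b %[mod m] -> frob a x = frob b x.
Proof. by move=> mx ab; rewrite -(frob_modn a mx) ab frob_modn. Qed.

(** The Frobenius permutes the roots of a polynomial over [F] vanishing at [x], so
    by finiteness and injectivity the iterates of [x] return to [x]. *)
Lemma frob_periodic x : exists m, (0 < m)%N /\ frob m x = x.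
Proof.
have [p pm px] := Fbar_algebraic x.
have p0 : map_poly iota p != 0 by rewrite map_poly_eq0 monic_neq0.
have rt i : root (map_poly iota p) (frob i x).
  rewrite -Frobenius_expE.
  have -> : map_poly iota p = map_poly (Frobenius iota ^+ i)%g (map_poly iota p).
    by rewrite -map_poly_comp; apply: eq_map_poly => a /=; rewrite gal_fix.
  by rewrite fmorph_root.
have : ~~ uniq (mkseq (frob ^~ x) (size (map_poly iota p))).
  apply/negP => u.
  have := max_poly_roots p0 _ u; rewrite size_mkseq ltnn => /(_ _)/negP; apply => //.
  by apply/allP => y /mapP[i _ ->].
move/(uniqPn 0) => [i [j [ij]]]; rewrite size_mkseq => js.
rewrite !nth_mkseq //; last exact: ltn_trans js.
rewrite -(subnK (ltnW ij)) addnC frobD => /frob_inj e.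
by exists (j - i)%N; rewrite subn_gt0.
Qed.

(** [X^(q^m) - X] is separable, as its derivative is [-1], so it has [q^m] distinct roots:
    they form the extension of degree [m] of [F]. *)
Lemma frob_fixed_seq m : (0 < m)%N ->
  exists rs : seq Fbar, [/\ uniq rs, size rs = (q ^ m)%N &
    forall x, (x \in rs) = (frob m x == x)].
Proof.
move=> m0; pose N := (q ^ m)%N; pose p : {poly Fbar} := 'X^N - 'X.
have N1 : (1 < N)%N by rewrite -(expn0 q) ltn_exp2l ?card_finField_gt1.
have szX : (size ('X : {poly Fbar}) < size ('X^N : {poly Fbar}))%N.
  by rewrite size_polyX size_polyXn ltnS.
have szp : size p = N.+1 by rewrite size_polyDl ?size_polyN // size_polyXn.
have mp : lead_coef p = 1.
  by rewrite lead_coefDl ?size_polyN // lead_coefXn.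
have q0 : (q%:R : Fbar) = 0.
  have q1 := card_finField_gt1.
  have := Frobenius_pnat iota => /pnatP/(_ _ (pdiv_prime q1) (pdiv_dvd _)) => H.
  have := H (ltnW q1) => pc; apply/eqP; rewrite -(dvdn_pcharf pc); exact: pdiv_dvd.
have N0 : (N%:R : Fbar) = 0 by rewrite /N natrX q0 expr0n (gtn_eqF m0).
have [rs Ers] := closed_field_poly_normal p; rewrite mp scale1r in Ers.
have sep : separable_poly p.
  rewrite unlock /p derivB derivXn derivX -scaler_nat N0 scale0r sub0r.
  by rewrite -(scaleN1r (1 : {poly Fbar})) coprimepZr ?coprimep1 // oppr_eq0 oner_eq0.
exists rs; split.
- by move: sep; rewrite Ers separable_prod_XsubC.
- by apply/eqP; rewrite -eqSS -szp Ers size_prod_XsubC.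
- by move=> x; rewrite -root_prod_XsubC -Ers /root !hornerE subr_eq0.
Qed.

(** The extension of degree [m] is generated by one root of unity, so that
    automorphisms can be compared on this extension by looking at one element. *)
Lemma frob_fixed_prim m : (0 < m)%N ->
  exists z, frob m z = z /\ forall x, frob m x = x -> x = 0 \/ exists k, x = z ^+ k.
Proof.
move=> m0; have [rs [urs srs mrs]] := frob_fixed_seq m0.
pose N := (q ^ m)%N.-1.
have q1 := card_finField_gt1.
have qm1 : (1 < q ^ m)%N by rewrite -(expn0 q) ltn_exp2l.
have N0 : (0 < N)%N by rewrite -ltnS prednK // ltnW.
have fE x : frob m x = x * x ^+ N by rewrite -exprS prednK // ltnW.
have zrs : 0 \in rs by rewrite mrs fE mul0r.
have ru : all N.-unity_root (rem 0 rs).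
  apply/allP => x; rewrite mem_rem_uniq // inE => /andP[x0].
  rewrite mrs fE unity_rootE => /eqP e; apply/eqP; apply: (mulfI x0).
  by rewrite mulr1.
have := has_prim_root N0 ru (rem_uniq _ urs).
rewrite size_rem // srs leqnn => /(_ isT)/hasP[z zr pz].
exists z; split; first by rewrite fE (prim_expr_order pz) mulr1.
move=> x xm; case: (eqVneq x 0) => [|x0]; [by left|right].
have xN : x ^+ N = 1 by apply: (mulfI x0); rewrite -fE mulr1.
by have [i ->] := prim_rootP pz xN; exists i.
Qed.

Lemma frob1_fixed x : frob 1 x = x -> exists a, x = iota a.
Proof.
move=> x1; have [rs [urs srs mrs]] := frob_fixed_seq (ltn0Sn 0).
pose s := [seq iota a | a <- enum F].
have us : uniq s by rewrite map_inj_uniq ?enum_uniq //; exact: fmorph_inj.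
have ss : {subset s <= rs}.
  by move=> y /mapP[a _ ->]; rewrite mrs frob_iota.
have sz : (size rs <= size s)%N by rewrite srs size_map -cardE expn1.
have [_ e] := uniq_min_size us ss sz.
have : x \in s by rewrite e mrs x1.
by case/mapP => a _ ->; exists a.
Qed.

(** The conjugates of a generator [z] of the extension of degree [m] are its Frobenius
    iterates, because the product of the [X - z^(q^i)] has Frobenius-invariant
    coefficients.  Thus [g] sends [z] to such an iterate. *)
Lemma gal_frob g m : (0 < m)%N ->
  exists a, forall x, frob m x = x -> g x = frob a x.
Proof.
move=> m0; have [z [zm zP]] := frob_fixed_prim m0.
(* The Frobenius shifts the factors cyclically, since frob m z = z. *)
pose P := \prod_(i < m) ('X - (frob i z)%:P).
have PF : map_poly (Frobenius iota) P = P.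
  transitivity (\prod_(i < m) ('X - (frob i.+1 z)%:P)).
    rewrite rmorph_prod; apply: eq_bigr => i _.
    apply: etrans (map_polyXsubC (gal_fun (Frobenius iota)) _) _; congr ('X - _%:P).
    have := Frobenius_expE 1 (frob i z); rewrite expg1 => ->.
    by rewrite -frobD add1n.
  rewrite /P; case: m m0 zm {zP P} => // m _ zm.
  by rewrite big_ord_recr big_ord_recl mulrC zm frob0.
have Pc i : exists a, P`_i = iota a.
  apply: frob1_fixed; rewrite -[in RHS]PF coef_map /=.
  by rewrite -Frobenius_expE expg1.
have gP : map_poly g P = P.
  by apply/polyP => i; rewrite coef_map; have [a ->] := Pc i; exact: gal_fix.
have : root P (g z).
  rewrite -gP fmorph_root /root horner_prod (bigD1 (Ordinal m0)) //=.
  by rewrite frob0 !hornerE subrr mul0r.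
rewrite /root horner_prod => /eqP/eqP; rewrite prodf_seq_eq0 => /hasP[i _ /=].
rewrite !hornerE subr_eq0 => /eqP gz; exists i => x /zP[->|[k ->]].
  by rewrite rmorph0 /frob expr0n expn_eq0 gtn_eqF // ltnW // card_finField_gt1.
by rewrite rmorphXn /= gz /frob -!exprM mulnC.
Qed.

(** The Frobenius has order exactly [m] on the extension of degree [m]: a smaller power
    fixes too few elements. *)
Lemma frob_exact m a b : (0 < m)%N ->
  (forall x, frob m x = x -> frob a x = frob b x) -> a = b %[mod m].
Proof.
move=> m0; wlog ab : a b / (a <= b)%N => [H E|E].
  by case: (leqP a b) => [/H|/ltnW/H H']; [exact|apply/esym/H' => x /E].
apply/esym/eqP; rewrite eqn_mod_dvd // /dvdn; apply/negPn/negP => d0.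
set d := ((b - a) %% m)%N in d0; rewrite -lt0n in d0.
have [rs [urs srs mrs]] := frob_fixed_seq m0.
have [ts [uts sts mts]] := frob_fixed_seq d0.
have sub : {subset rs <= ts}.
  move=> x; rewrite mrs mts => /eqP xm; apply/eqP.
  rewrite frob_modn //; apply: (@frob_inj a).
  by rewrite -frobD subnKC // E.
have := uniq_leq_size urs sub; rewrite srs sts leqNgt ltn_exp2l ?ltn_mod ?m0 //.
exact: card_finField_gt1.
Qed.

(** The Galois group is the full profinite completion of the integers: a compatible
    system of residues [b m] modulo [m] defines an automorphism, acting on the
    extension of degree [m] as the [b m]-th power of the Frobenius. *)
Lemma gal_of_compatible (b : nat -> nat) :
  (forall m n, (0 < n)%N -> (m %| n)%N -> b m = b n %[mod m]) ->
  exists h, forall m x, (0 < m)%N -> frob m x = x -> h x = frob (b m) x.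
Proof.
move=> bP.
pose per x := sval (cid (frob_periodic x)).
have perP x : (0 < per x)%N /\ frob (per x) x = x by rewrite /per; case: cid.
pose f x := frob (b (per x)) x.
have fE m x : (0 < m)%N -> frob m x = x -> f x = frob (b m) x.
  move=> m0 mx; have [p0 px] := perP x; have mp0 : (0 < m * per x)%N by rewrite muln_gt0 m0.
  rewrite /f (frob_eqmod px (bP _ _ mp0 (dvdn_mull _ _))) //.
  by rewrite -(frob_eqmod mx (bP _ _ mp0 (dvdn_mulr _ _))).
have common x y : exists m, [/\ (0 < m)%N, frob m x = x & frob m y = y].
  have [[p0 px] [r0 ry]] := (perP x, perP y); exists (per x * per y)%N.
  split; rewrite ?muln_gt0 ?p0 //; last exact: frob_iter.
  by rewrite mulnC frob_iter.
have fB : zmod_morphism f.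
  move=> x y; have [m [m0 mx my]] := common x y.
  by rewrite !(fE m) // ?frobB ?mx ?my.
have fM : monoid_morphism f.
  split=> [|x y]; first by rewrite /f frob1.
  have [m [m0 mx my]] := common x y.
  by rewrite !(fE m) // ?frobM ?mx ?my.
pose fa := GRing.isZmodMorphism.Build _ _ f fB.
pose fm := GRing.isMonoidMorphism.Build _ _ f fM.
pose fr : {rmorphism Fbar -> Fbar} := HB.pack f fa fm.
have sur y : exists x, f x = y.
  have [p0 py] := perP y; set m := per y in p0 py.
  (* The exponent is congruent to - b m modulo m and nonnegative. *)
  pose c := (b m * m - b m)%N; exists (frob c y).
  have mc : frob m (frob c y) = frob c y by rewrite -frobD addnC frobD py.
  by rewrite (fE m) // -frobD subnKC ?frob_iter // leq_pmulr.
have frbij : bijective fr.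
  pose k y := sval (cid (sur y)).
  have fK : cancel k fr by move=> y; rewrite /k; case: cid.
  by exists k => // x; apply: (fmorph_inj fr); rewrite fK.
have ffix a : fr (iota a) = iota a by exact: frob_iota.
by exists (AbsGal frbij ffix).
Qed.

(** In the profinite integers, [Z] is dense and the subgroup of multiples of [N] is
    open, so together they exhaust everything.  Concretely, if [g] acts on the
    extension of degree [m] by the exponent [a m], then [a (N m)] has a remainder
    modulo [N] independent of [m], and the quotients by [N] form a compatible system,
    which defines [h]. *)
Lemma gal_decomp g N : (0 < N)%N ->
  exists k h, g = (Frobenius iota ^+ k * h ^+ N)%g.
Proof.
move=> N0.
pose a m := if (0 < m)%N =P true is ReflectT m0 then sval (cid (gal_frob g m0)) else 0%N.
have aP m x : (0 < m)%N -> frob m x = x -> g x = frob (a m) x.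
  rewrite /a; case: eqP => // m0 _; case: cid => /= k; exact.
have aC m n : (0 < n)%N -> (m %| n)%N -> a m = a n %[mod m].
  move=> n0 mn; have m0 := dvdn_gt0 n0 mn; apply: frob_exact => // x mx.
  by rewrite -!aP //; exact: frob_dvd mx.
pose b m := (a (N * m) %/ N)%N.
have aE m : (0 < m)%N -> a (N * m)%N = (a N %% N + N * b m)%N.
  move=> m0; rewrite (divn_eq (a (N * m)%N) N) mulnC addnC; congr (_ + _)%N.
  by apply/esym/aC; rewrite ?muln_gt0 ?N0 ?dvdn_mulr.
have bC m n : (0 < n)%N -> (m %| n)%N -> b m = b n %[mod m].
  move=> n0 mn; have m0 := dvdn_gt0 n0 mn.
  have /eqP : a (N * m)%N = a (N * n)%N %[mod N * m].
    by apply: aC; rewrite ?muln_gt0 ?N0 ?dvdn_pmul2l.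
  by rewrite !aE // eqn_modDl -!muln_modr eqn_pmul2l // => /eqP.
have [h hP] := gal_of_compatible bC.
exists (a N %% N)%N, h; apply: absGalP => x.
have [m [m0 mx]] := frob_periodic x.
have hN j : (h ^+ j)%g x = frob (j * b m) x.
  elim: j => [|j IH]; first by rewrite expg0 frob0.
  rewrite expgS; change (h ((h ^+ j)%g x) = frob (j.+1 * b m) x).
  by rewrite IH frob_gal (hP m) // -frobD mulSn addnC.
change (g x = (Frobenius iota ^+ (a N %% N))%g ((h ^+ N)%g x)).
rewrite hN Frobenius_expE -frobD -aE //; apply: aP; first by rewrite muln_gt0 N0.
exact: frob_iter.
Qed.

End Galois.

(** * Finite orbits *)

Section FiniteSets.
Local Open Scope classical_set_scope.

Lemma ncard_uniq (T : Type) (A : set T) (s : seq {classic T}) :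
  uniq s -> (forall x, (x \in s) <-> A x) -> finite_set A /\ ncard A = size s.
Proof.
move=> us sA.
have E : (A : set {classic T}) = [set` s].
  by apply/seteqP; split=> x /=; rewrite sA.
split; first by have := finite_seq s; rewrite -E.
rewrite /ncard E; have -> : [set` s] = [set` [fset x in s]%fset].
  by apply/seteqP; split=> x /=; rewrite inE.
by rewrite set_fsetK card_fseq undup_id.
Qed.

Lemma finite_enum (T : Type) (A : set T) : finite_set A ->
  exists s : seq {classic T}, [/\ uniq s, forall x, (x \in s) <-> A x & size s = ncard A].
Proof.
move=> fA; exists (fset_set (A : set {classic T})); split=> [|x|//]; first exact: fset_uniq.
by rewrite (@in_fset_set {classic T}) // inE.
Qed.

Lemma finite_pigeonhole (T : Type) (A : set T) (f : nat -> T) :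
  finite_set A -> (forall i, A (f i)) ->
  exists i j, [/\ (i < j)%N, (j <= ncard A)%N & f i = f j].
Proof.
move=> /finite_enum[s [us sA <-]] fA.
pose t : seq {classic T} := mkseq f (size s).+1.
have : ~~ uniq t.
  apply/negP => ut.
  have : (size t <= size s)%N by apply: uniq_leq_size => // y /mapP[i _ ->]; apply/sA.
  by rewrite size_mkseq ltnn.
move/(uniqPn (f 0%N : {classic T})) => [i [j [ij]]]; rewrite size_mkseq ltnS => js.
rewrite !nth_mkseq //; last by rewrite ltnS (leq_trans _ js) // ltnW.
by exists i, j.
Qed.

End FiniteSets.

Section GSet.
Local Open Scope classical_set_scope.
Variables (G : groupType) (M : gset G).
Implicit Types (x y : M) (g h : G).

Lemma gact_expD g i j x :
  gact (g ^+ (i + j))%g x = gact (g ^+ i)%g (gact (g ^+ j)%g x).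
Proof. by rewrite expgnDr gactM. Qed.

Lemma gact_expM g i j x : gact (g ^+ j)%g x = x -> gact (g ^+ (i * j))%g x = x.
Proof.
move=> gx; elim: i => [|i IH]; first by rewrite mul0n expg0 gact1.
by rewrite mulSn gact_expD IH.
Qed.

Lemma gact_inj g : injective (gact g : M -> M).
Proof.
by move=> x y e; rewrite -(gact1 x) -(gact1 y) -(mulVg g) !gactM e.
Qed.

Lemma gorbit_refl x : gorbit x x.
Proof. by exists 1%g => //; exact: gact1. Qed.

Lemma gorbit_eq x y : gorbit x y -> gorbit y = gorbit x.
Proof.
case=> g _ <-; apply/seteqP; split=> z [h _ <-].
  by exists (h * g)%g => //; rewrite gactM.
by exists (h * g^-1)%g => //; rewrite gactM -(gactM _ _ x) mulVg gact1.
Qed.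

Lemma gorbits_gorbit (nu : set M) x : gorbits nu -> nu x -> nu = gorbit x.
Proof. by case=> y _ <- /gorbit_eq. Qed.

Lemma gact_period g x : finite_set (gorbit x) ->
  exists j, (0 < j <= ncard (gorbit x))%N /\ gact (g ^+ j)%g x = x.
Proof.
move=> fO; have [|i [j [ij jn e]]] := finite_pigeonhole (f := fun i => gact (g ^+ i)%g x) fO.
  by move=> i; exists (g ^+ i)%g.
exists (j - i)%N; rewrite subn_gt0 ij (leq_trans (leq_subr _ _)) //; split=> //.
by apply: (@gact_inj (g ^+ i)%g); rewrite -gact_expD subnKC ?(ltnW ij) // -e.
Qed.

Lemma locally_finite_le : locally_finite M ->
  forall n, finite_set [set nu : set M | gorbits nu /\ (ncard nu <= n)%N].
Proof.
move=> [_ lf] n.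
apply: sub_finite_set (bigcup_finite (finite_II n.+1) (fun i _ => lf i)).
by move=> nu [Onu nun]; exists (ncard nu).
Qed.

End GSet.

Section FrobeniusOrbits.
Local Open Scope classical_set_scope.
Variables (F : finFieldType) (Fbar : closedFieldType).
Variable iota : {rmorphism F -> Fbar}.
Hypothesis Fbar_algebraic : integralRange iota.
Local Notation phi := (Frobenius iota).
Variable M : gset (absGal iota).
Implicit Types (x y : M).

(** In the decomposition [g = phi^k h^N] of [gal_decomp] with [N] the factorial of the
    size of the orbit, [h^N] fixes every point of the orbit. *)
Lemma gorbit_Frobenius x g : finite_set (gorbit x) ->
  exists k, gact g x = gact (phi ^+ k)%g x.
Proof.
move=> fO; have [k [h ->]] := gal_decomp Fbar_algebraic g (fact_gt0 (ncard (gorbit x))).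
exists k; rewrite gactM; congr gact.
have [j [jn hj]] := gact_period h fO.
by have /dvdnP[i ->] := dvdn_fact jn; exact: gact_expM.
Qed.

(** By [gorbit_Frobenius] the Frobenius permutes a finite orbit in a single cycle, whose
    length is both the degree of the orbit and the period of each of its points. *)
Lemma gorbit_degP x : finite_set (gorbit x) ->
  (0 < ncard (gorbit x))%N /\
  forall r, gact (phi ^+ r)%g x = x <-> (ncard (gorbit x) %| r)%N.
Proof.
move=> fO.
have ex : exists j, (0 < j)%N && `[< gact (phi ^+ j)%g x = x >].
  have [j [/andP[j0 _] e]] := gact_period phi fO.
  by exists j; rewrite j0; apply/asboolP.
case: (ex_minnP ex) => d /andP[d0 /asboolP dx] dmin.
have modE k : gact (phi ^+ k)%g x = gact (phi ^+ (k %% d))%g x.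
  by rewrite {1}(divn_eq k d) addnC gact_expD gact_expM.
have dP r : gact (phi ^+ r)%g x = x <-> (d %| r)%N.
  split=> [rx|/dvdnP[k ->]]; last exact: gact_expM.
  rewrite /dvdn eqn0Ngt; apply/negP => r0.
  have := dmin (r %% d)%N; rewrite r0 /= leqNgt ltn_mod d0 => H.
  by suff: false by []; apply: H; apply/asboolP; rewrite -modE.
suff -> : ncard (gorbit x) = d by [].
pose s : seq {classic gcarrier M} := mkseq (fun k => gact (phi ^+ k)%g x) d.
have us : uniq s.
  apply/mkseq_uniqP => i j; rewrite !inE => id jd.
  wlog ij : i j id jd / (i <= j)%N => [H|e].
    by case: (leqP i j) => [/H|/ltnW/H H' e]; [exact|apply/esym/H'].
  have /dP : gact (phi ^+ (j - i))%g x = x.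
    by apply: (@gact_inj _ M (phi ^+ i)%g); rewrite -gact_expD subnKC.
  have := leq_ltn_trans (leq_subr i j) jd.
  case: (posnP (j - i)%N) => [/eqP|p0 lt /dvdn_leq -/(_ p0)].
    by rewrite subn_eq0 => ji _ _; apply/eqP; rewrite eqn_leq ij.
  by rewrite leqNgt lt.
have sP y : (y \in s) <-> gorbit x y.
  split=> [/mapP[k _ ->]|[g _ <-]]; first by exists (phi ^+ k)%g.
  have [k ->] := gorbit_Frobenius g fO; rewrite modE.
  by apply/mapP; exists (k %% d)%N => //; rewrite mem_iota /= add0n ltn_mod.
by rewrite (ncard_uniq us sP).2 size_mkseq.
Qed.

Lemma ncard_gorbits_gt0 nu : locally_finite M -> @gorbits _ M nu -> (0 < ncard nu)%N.
Proof.
move=> [fin _] Onu; case: (Onu) => x _ E.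
by have := (@gorbit_degP x); rewrite E => /(_ (fin _ Onu))[].
Qed.

(** Rational points are counted orbit by orbit: an orbit of degree [d] is a
    single [d]-cycle of the Frobenius. *)
Lemma ncard_fixed_points n r (s : seq (set M)) : locally_finite M ->
  (0 < r <= n)%N -> uniq s ->
  (forall nu, (nu \in s) <-> (gorbits nu /\ (ncard nu <= n)%N)) ->
  ncard (fixed_points M (phi ^+ r)%g) = (\sum_(nu <- s | ncard nu %| r) ncard nu)%N.
Proof.
move=> [fin lf] /andP[r0 rn] us sP.
have fixP x : fixed_points M (phi ^+ r)%g x <-> (ncard (gorbit x) %| r)%N.
  by apply: (gorbit_degP _).2; apply: fin; exists x.
have fins x : fixed_points M (phi ^+ r)%g x -> gorbit x \in s.
  move=> /fixP d; apply/sP; split; first by exists x.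
  by rewrite (leq_trans (dvdn_leq r0 d)).
have fX : finite_set (fixed_points M (phi ^+ r)%g).
  apply: (@sub_finite_set _ _ (\bigcup_(nu in [set` s]) nu)).
    by move=> x /fins xs; exists (gorbit x) => //; exact: gorbit_refl.
  by apply: bigcup_finite; [exact: finite_seq|move=> nu /sP[Onu _]; exact: fin].
have [t [ut tP <-]] := finite_enum fX.
transitivity (\sum_(x <- t) \sum_(nu <- s) (nu == gorbit x))%N.
  rewrite -sum1_size big_seq [RHS]big_seq; apply: eq_bigr => x /tP /fins xs.
  rewrite (bigD1_seq (gorbit x)) //= eqxx big1 // => nu /negPf ->.
  by [].
rewrite exchange_big /= [RHS]big_mkcond /= big_seq [RHS]big_seq.
apply: eq_bigr => nu /sP[Onu nun]; case: ifP => nur.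
  have [w [uw wP <-]] := finite_enum (fin _ Onu).
  rewrite -sum1_size -(big_mkcond (fun x => nu == gorbit x) (fun=> 1%N)) /= -big_filter.
rewrite !sum1_size; apply: (@perm_size {classic gcarrier M}).
  apply: uniq_perm; rewrite ?filter_uniq // => x.
  rewrite mem_filter; apply/idP/idP=> [/andP[/eqP e _]|/wP nux].
    by apply/wP; rewrite e; exact: gorbit_refl.
  have e := gorbits_gorbit Onu nux; rewrite -e eqxx /=; apply/tP/fixP.
  by rewrite -e.
rewrite big_seq big1 // => x /tP/fixP; case: eqP => // <-.
by rewrite nur.
Qed.

End FrobeniusOrbits.

(** * The zeta function counts rational points *)

Section ProjectiveLine.
Local Open Scope classical_set_scope.
Variables (F : finFieldType) (Fbar : closedFieldType).
Variable iota : {rmorphism F -> Fbar}.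
Hypothesis Fbar_algebraic : integralRange iota.
Local Notation phi := (Frobenius iota).
Local Notation P1 := (P1 iota).

(** The point at infinity accounts for the successor. *)
Lemma ncard_fixed_points_P1 r : (0 < r)%N ->
  finite_set (fixed_points P1 (phi ^+ r)%g) /\
  ncard (fixed_points P1 (phi ^+ r)%g) = (#|F| ^ r).+1.
Proof.
move=> r0; have [rs [urs <- rsP]] := frob_fixed_seq iota r0.
pose s : seq {classic gcarrier P1} := None :: map Some rs.
have -> : (size rs).+1 = size s by rewrite /= size_map.
apply: ncard_uniq => [|x].
  rewrite /=; apply/andP; split; first by apply/mapP => -[].
  by rewrite (@map_inj_uniq Fbar {classic option Fbar}) // => x y [].
case: x => [x|]; last by rewrite inE eqxx; split.
have -> : fixed_points P1 (phi ^+ r)%g (Some x) = (Some (frob F r x) = Some x).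
  by rewrite -(Frobenius_expE iota).
rewrite inE /=; split.
  by case/orP=> [/eqP//|/mapP[y]]; rewrite rsP => /eqP yr [->]; rewrite yr.
by case=> e; apply/orP; right; apply/mapP; exists x => //; rewrite rsP e.
Qed.

Lemma P1_locally_finite : locally_finite P1.
Proof.
have fin : forall x : P1, finite_set (gorbit x).
  case=> [x|]; last first.
    by apply: sub_finite_set (finite_set1 None) => _ [g _ <-].
  have [m [m0 mx]] := frob_periodic Fbar_algebraic x.
  apply: sub_finite_set (finite_image (fun a => Some (frob F a x)) (finite_II m)).
  move=> _ [g _ <-]; have [a aP] := gal_frob g m0.
  exists (a %% m)%N; first by rewrite /= ltn_mod.
  by rewrite (frob_modn _ mx) -aP.
split=> [_ [x _ <-]//|n].
have [->|n0] := posnP n.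
  apply: sub_finite_set (finite_set0 _) => nu [[x _ <-] e].
  by have [] := gorbit_degP Fbar_algebraic (fin x); rewrite e.
apply: sub_finite_set (finite_image (@gorbit _ P1) (ncard_fixed_points_P1 n0).1).
move=> nu [[x _ <-] e]; exists x => //.
by apply/(gorbit_degP Fbar_algebraic (fin x)).2; rewrite e.
Qed.

End ProjectiveLine.

Section Zeta.
Local Open Scope classical_set_scope.
Variables (F : finFieldType) (Fbar : closedFieldType).
Variable iota : {rmorphism F -> Fbar}.
Hypothesis Fbar_algebraic : integralRange iota.
Local Notation phi := (Frobenius iota).
Variable M : gset (absGal iota).
Hypothesis M_lf : locally_finite M.

Definition orbits_upto (n : nat) : seq (set M) :=
  fset_set [set nu : set M | gorbits nu /\ (ncard nu <= n)%N].

Lemma orbits_uptoP n nu :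
  (nu \in orbits_upto n) <-> (gorbits nu /\ (ncard nu <= n)%N).
Proof.
by rewrite /orbits_upto in_fset_set ?inE //; exact: locally_finite_le.
Qed.

Lemma orbits_upto_uniq n : uniq (orbits_upto n).
Proof. exact: fset_uniq. Qed.

Lemma orbits_upto_deg_gt0 n nu : nu \in orbits_upto n -> (0 < ncard nu)%N.
Proof. by move=> /orbits_uptoP[Onu _]; exact: ncard_gorbits_gt0 Onu. Qed.

Definition euler_product (n : nat) : fps int :=
  \prod_(nu <- orbits_upto n) fps_multiples _ (ncard nu).

Lemma poly_fps_multiplesV d : (0 < d)%N ->
  (poly_fps (1 - 'X^d : {poly int}))^-1 = fps_multiples _ d.
Proof.
move=> d0; have H := fps_multiplesP int d0.
have u : poly_fps (1 - 'X^d : {poly int}) \is a GRing.unit.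
  by apply/unitrPr; exists (fps_multiples _ d).
by apply: (mulrI u); rewrite divrr // H.
Qed.

(** The Euler factors of degree larger than [n] are [1] modulo [t^(n+1)]. *)
Lemma fps_coef_zeta n m : (n <= m)%N ->
  fps_coef (zeta M) n = fps_coef (euler_product m) n.
Proof.
have zE k : fps_coef (zeta M) k = fps_coef (euler_product k) k.
  rewrite /zeta /= fsbig_finite; last exact: locally_finite_le.
  rewrite /euler_product; congr (fps_coef _ k).
  rewrite big_seq [RHS]big_seq; apply: eq_bigr => nu /orbits_upto_deg_gt0.
  exact: poly_fps_multiplesV.
move=> nm; rewrite zE.
have -> : euler_product m = euler_product n *
    \prod_(nu <- orbits_upto m | ~~ (ncard nu <= n)%N) fps_multiples _ (ncard nu).
  rewrite /euler_product (bigID (fun nu => ncard nu <= n)%N) /=; congr (_ * _).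
  rewrite -big_filter; apply: perm_big; apply: uniq_perm.
  - by rewrite filter_uniq // orbits_upto_uniq.
  - exact: orbits_upto_uniq.
  move=> nu; rewrite mem_filter; apply/andP/idP => [[nun]|].
    by move=> /orbits_uptoP[Onu _]; apply/orbits_uptoP.
  move=> /orbits_uptoP[Onu nun]; split=> //; apply/orbits_uptoP; split=> //.
  exact: leq_trans nm.
rewrite fps_coefM_eq1_upto //.
apply: fps_eq1_upto_prod => nu; rewrite -ltnNge => nnu i ni /=.
case: i ni => [|i] ni; first by rewrite dvdn0.
by rewrite gtnNdvd //; exact: leq_ltn_trans nnu.
Qed.

Definition num_rational (r : nat) := ncard (fixed_points M (phi ^+ r)%g).

Definition rational_series : fps int :=
  FPS (fun r => if r is 0 then 0 else (num_rational r)%:R).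

Lemma zeta_coef0 : fps_coef (zeta M) 0 = 1.
Proof.
rewrite (fps_coef_zeta (leqnn 0)) /euler_product big_seq big1 // => nu.
move=> nu0; have := orbits_upto_deg_gt0 nu0.
by move: nu0 => /orbits_uptoP[_]; rewrite leqn0 => /eqP->.
Qed.

(** Summing the logarithmic derivatives of the Euler factors regroups, at index [r], the
    degrees of the orbits of degree dividing [r]; by [ncard_fixed_points] these
    add up to the number of rational points. *)
Lemma fps_theta_zeta : fps_theta (zeta M) = zeta M * rational_series.
Proof.
apply: fpsP => n.
transitivity (fps_coef (fps_theta (euler_product n)) n).
  by congr (_ *+ n); exact: fps_coef_zeta.
have -> : fps_theta (euler_product n) =
    euler_product n *
    \sum_(nu <- orbits_upto n) ((fps_multiples _ (ncard nu) - 1) *+ ncard nu).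
  rewrite /euler_product; have := @orbits_upto_deg_gt0 n.
  elim: (orbits_upto n) => [|nu s IH] s0; first by rewrite !big_nil mulr0 fps_theta1.
  rewrite !big_cons fps_thetaM IH => [|mu mus]; last by apply: s0; rewrite inE mus orbT.
  by rewrite fps_theta_multiples ?s0 ?mem_head // mulrDr mulrAC -!mulrA.
rewrite !fps_coefM; apply: eq_bigr => i _.
have ni : (i <= n)%N by rewrite -ltnS.
rewrite (fps_coef_zeta ni); congr (_ * _).
have := leq_subr i n; move: (n - i)%N => [|r] rn.
  rewrite fps_coef_sum big1 // => nu _.
  by rewrite fps_coefMn fps_coefD /= dvdn0 subrr mul0rn.
have rr : (0 < r.+1 <= n)%N by rewrite rn.
rewrite /= /num_rational.
rewrite (ncard_fixed_points Fbar_algebraic M_lf rr (orbits_upto_uniq n) (orbits_uptoP n)).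
rewrite fps_coef_sum natr_sum [RHS]big_mkcond /=; apply: eq_bigr => nu _.
rewrite fps_coefMn fps_coefD fps_coefN fps_coef1 subr0 /=.
by case: ifP => _ //; rewrite mul0rn.
Qed.

End Zeta.

(** * The zeta function counts effective divisors *)

Section CountingDivisors.
Variables (K : choiceType) (deg : K -> nat) (n : nat) (t : seq K).
Hypothesis t_uniq : uniq t.
Hypothesis deg_gt0 : forall x, (0 < deg x)%N.
Hypothesis tP : forall x, (x \in t) = (deg x <= n)%N.
Local Notation k := (size t).
Local Notation pt := (tnth (in_tuple t)).
Implicit Types (f : {ffun 'I_k -> 'I_n.+1}) (D : {freeg K / int}).

(** The degree of the divisor with multiplicity [f i] at the [i]-th point of [t].  As
    points have positive degree, multiplicities at most [n] suffice in degree [n]. *)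
Definition weight f := (\sum_(i < k) f i * deg (pt i))%N.

Lemma weightZ f : (weight f)%:Z = \sum_(i < k) (f i)%:Z * (deg (pt i))%:Z.
Proof. by rewrite /weight (big_morph Posz PoszD erefl). Qed.

(** Up to index [n], each factor can be replaced by a geometric sum of [n + 1] terms;
    distributing the product over these sums gives one monomial for each choice of
    multiplicities. *)
Lemma fps_coef_euler_product :
  fps_coef (\prod_(x <- t) fps_multiples int (deg x)) n =
  #|[pred f | weight f == n]|%:R.
Proof.
pose p (i : 'I_k) : {poly int} := \sum_(j < n.+1) 'X^(j * deg (pt i)).
transitivity ((\prod_(i < k) p i)`_n).
  suff : forall j, (j <= n)%N -> fps_coef (\prod_(x <- t) fps_multiples int (deg x)) j =
      fps_coef (\prod_(i < k) poly_fps (p i)) j.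
    move=> /(_ n (leqnn n)) ->.
    have <- : poly_fps (\prod_(i < k) p i) = \prod_(i < k) poly_fps (p i).
      by apply: big_morph; [exact: poly_fpsM|exact: poly_fps1].
    by [].
  rewrite big_tnth; elim/big_rec2: _ => // i a b _ IH j jn.
  rewrite !fps_coefM; apply: eq_bigr => l _; rewrite IH ?(leq_trans (leq_subr _ _)) //.
  congr (_ * _); rewrite /= /p coef_sum.
  have ln : (l <= n)%N by rewrite (leq_trans _ jn) // -ltnS.
  case: (boolP (_ %| _)%N) => [/dvdnP[c lE]|ndv].
    have cn : (c < n.+1)%N.
      by rewrite ltnS (leq_trans _ ln) // lE leq_pmulr.
    rewrite (bigD1 (Ordinal cn)) //= coefXn lE eqxx big1 ?addr0 // => c'.
    rewrite -val_eqE /= coefXn eqn_pmul2r // => /negPf.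
    by rewrite eq_sym => ->.
  rewrite big1 // => c _; rewrite coefXn; case: eqP => // lE.
  by rewrite lE dvdn_mull in ndv.
rewrite bigA_distr_bigA /= coef_sum -sum1_card natr_sum big_mkcond /=.
rewrite [RHS]big_mkcond /=; apply: eq_bigr => f _.
have -> : \prod_(i < k) ('X^(f i * deg (pt i)) : {poly int}) = 'X^(weight f).
  by rewrite /weight; elim/big_rec2: _ => [|i a b _ ->]; rewrite ?expr0 ?exprD.
by rewrite coefXn inE eq_sym; case: eqP.
Qed.

Definition divisor_of f : {freeg K / int} :=
  [freeg [seq ((f i)%:Z, pt i) | i <- enum 'I_k]].

Lemma coeff_divisor_of f x :
  coeff x (divisor_of f) = \sum_(i < k | pt i == x) (f i)%:Z.
Proof. by rewrite coeff_Freeg /precoeff big_map big_enum_cond. Qed.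

Lemma pt_inj : injective pt.
Proof. exact/tuple_uniqP. Qed.

Lemma coeff_divisor_of_pt f i : coeff (pt i) (divisor_of f) = (f i)%:Z.
Proof.
rewrite coeff_divisor_of (big_pred1 i) // => j /=.
by rewrite (inj_eq pt_inj).
Qed.

Lemma divisor_of_inj : injective divisor_of.
Proof.
move=> f g e; apply/ffunP => i; apply/val_inj.
have := coeff_divisor_of_pt f i; rewrite e coeff_divisor_of_pt => -[].
by move/esym.
Qed.

Lemma deg_divisor_widen D : {subset dom D <= t} ->
  \sum_(x <- dom D) coeff x D * (deg x)%:Z = \sum_(i < k) coeff (pt i) D * (deg (pt i))%:Z.
Proof.
move=> sub; rewrite -(big_tnth _ _ t xpredT (fun x => coeff x D * (deg x)%:Z)).
rewrite [RHS](bigID (mem (dom D))) /= [X in _ + X]big1 ?addr0; last first.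
  by move=> x /coeff_outdom ->; rewrite mul0r.
rewrite -[RHS]big_filter; apply: perm_big; apply: uniq_perm.
- exact: uniq_dom.
- by rewrite filter_uniq.
- move=> x; rewrite mem_filter; case: (boolP (x \in dom D)) => //= xD.
  by rewrite sub.
Qed.

(** Degrees being positive, an effective divisor of degree [n] is supported on points of
    degree at most [n], with multiplicities at most [n]: it is a [divisor_of f]. *)
Lemma card_effective :
  ncard [set D : {freeg K / int} | (forall x, coeff x D != 0 -> 0 < coeff x D) /\
     \sum_(x <- dom D) coeff x D * (deg x)%:Z = n%:Z]%classic
  = #|[pred f | weight f == n]|.
Proof.
rewrite cardE -(size_map divisor_of).
pose s : seq {classic {freeg K / int}} := map divisor_of (enum [pred f | weight f == n]).
apply: (ncard_uniq (s := s) _ _).2.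
  by rewrite (@map_inj_uniq _ {classic {freeg K / int}}) ?enum_uniq //; exact: divisor_of_inj.
move=> D; split.
  move=> /mapP[f]; rewrite mem_enum inE => /eqP fn ->; split.
    move=> x; rewrite coeff_divisor_of => x0.
    by rewrite lt_neqAle eq_sym x0 sumr_ge0.
  have sub : {subset dom (divisor_of f) <= t}.
    move=> x; apply: contraTT => xt; rewrite mem_dom negbK coeff_divisor_of big1 // => i /eqP e.
    by move: xt; rewrite -e mem_tnth.
  rewrite deg_divisor_widen // -fn weightZ.
  by apply: eq_bigr => i _; rewrite coeff_divisor_of_pt.
case=> eff degD.
have sub0 x : x \in dom D -> coeff x D * (deg x)%:Z <= n%:Z.
  move=> xD; rewrite -degD (bigD1_seq x) ?uniq_dom //= lerDl.
  rewrite big_seq_cond; apply: sumr_ge0 => y /andP[yD _].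
  by rewrite mulr_ge0 // ltW // eff // -mem_dom.
have ge0 x : 0 <= coeff x D.
  by case: (eqVneq (coeff x D) 0) => [->|/eff/ltW].
have bnd x : x \in dom D -> (`|coeff x D| * deg x <= n)%N.
  by move=> /sub0; rewrite -lez_nat PoszM gez0_abs.
have sub : {subset dom D <= t}.
  move=> x xD; rewrite tP (leq_trans _ (bnd x xD)) // leq_pmull //.
  by rewrite absz_gt0 -mem_dom.
have cn x : (`|coeff x D| < n.+1)%N.
  case: (boolP (x \in dom D)) => [xD|/coeff_outdom->] //.
  by rewrite ltnS (leq_trans _ (bnd x xD)) // leq_pmulr.
pose f : {ffun 'I_k -> 'I_n.+1} := [ffun i => Ordinal (cn (pt i))].
have fE i : (f i)%:Z = coeff (pt i) D by rewrite ffunE /= gez0_abs.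
apply/mapP; exists f.
  rewrite mem_enum inE -eqz_nat -degD deg_divisor_widen // weightZ; apply/eqP.
  by apply: eq_bigr => i _; rewrite -fE.
apply: (eqP (_ : (D : {freeg K / int}) == divisor_of f)); apply/freeg_eqP => x.
case: (boolP (x \in t)) => [/seq_tnthP[i ->]|xt]; first by rewrite coeff_divisor_of_pt fE.
rewrite coeff_divisor_of big1 => [|i /eqP e]; last by move: xt; rewrite -e mem_tnth.
by apply: coeff_outdom; apply: contra xt; exact: sub.
Qed.

End CountingDivisors.

(** Orbits of degree larger than [n] appear neither in an effective divisor of degree [n]
    nor in the [n]-th coefficient. *)
Lemma num_effectiveE (F : finFieldType) (Fbar : closedFieldType)
  (iota : {rmorphism F -> Fbar}) (Fbar_algebraic : integralRange iota)
  (M : gset (absGal iota)) (M_lf : locally_finite M) n :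
  (num_effective M n)%:R = fps_coef (zeta M) n.
Proof.
rewrite (fps_coef_zeta Fbar_algebraic M_lf (leqnn n)) /euler_product.
pose t : seq (@gorbits _ M) := pmap insub (orbits_upto M n).
have vt : map val t = orbits_upto M n.
  rewrite /t (@pmap_filter _ _ _ val); last exact: insubK.
  apply/all_filterP/allP => nu /(orbits_uptoP M_lf)[Onu _].
  by rewrite /= isSome_insub inE.
rewrite -vt big_map.
have d0 (x : @gorbits _ M) : (0 < ncard (val x))%N.
  by apply: (ncard_gorbits_gt0 Fbar_algebraic M_lf); have := valP x; rewrite inE.
have tu : uniq t by apply: (map_uniq (f := val)); rewrite vt orbits_upto_uniq.
have tP (x : @gorbits _ M) : (x \in t) = (ncard (val x) <= n)%N.
  rewrite -(mem_map val_inj) vt; apply/idP/idP => [/(orbits_uptoP M_lf)[]//|xn].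
  by apply/(orbits_uptoP M_lf); split=> //; have := valP x; rewrite inE.
rewrite (fps_coef_euler_product (deg := fun x => ncard (val x))) //.
by rewrite -(card_effective tu d0 tP).
Qed.

(** * Residues of rational functions with two simple poles *)

Section SimplePoles.
Import numFieldNormedType.Exports.
Local Open Scope classical_set_scope.
Variable C : numClosedFieldType.
Implicit Types (a b z : C) (g : {poly C}).

Lemma near_neq a b : a != b -> \forall z \near b, z != a.
Proof.
rewrite eq_sym -subr_eq0 => ab.
have ab0 : 0 < `|b - a| by rewrite normr_gt0.
near=> z; have : `|b - z| < `|b - a| by near: z; apply: (@cvgr_dist_lt _ C^o).
by apply: contraTneq => ->; rewrite ltxx.
Unshelve. all: by end_near. Qed.

Lemma derivable_pole a b z : z != b ->
  derivable ((fun x => a / (x - b)) : C^o -> C^o) z 1.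
Proof.
move=> zb.
apply: (@derivableM _ _ (cst a : C^o -> C^o) (fun x : C^o => (x - b)^-1 : C^o)).
  exact: derivable_cst.
apply: (@derivableV _ _ (fun x : C^o => (x - b) : C^o)).
  by rewrite /= subr_eq0.
apply: derivableB; [exact: derivable_id|exact: derivable_cst].
Qed.

Lemma derivable_poly g z : derivable (horner g : C^o -> C^o) z 1.
Proof.
elim/poly_ind: g => [|g c IH].
  have -> : horner (0 : {poly C}) = cst 0 by apply/funext => y; rewrite horner0.
  exact: derivable_cst.
have -> : horner (g * 'X + c%:P) = (fun x : C^o => g.[x] * x : C^o) \+ cst c.
  by apply/funext => y /=; rewrite !hornerE.
apply: derivableD; last exact: derivable_cst.
by apply: (@derivableM _ _ (horner g : C^o -> C^o) id) => //; exact: derivable_id.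
Qed.

(** Keeping the poles in the form [a / (z - b)] makes the residues visible as numerators. *)
Definition two_poles g a1 b1 a2 b2 z : C := g.[z] + a1 / (z - b1) + a2 / (z - b2).

Lemma derivable_two_poles g a1 b1 a2 b2 z : z != b1 -> z != b2 ->
  derivable (two_poles g a1 b1 a2 b2 : C^o -> C^o) z 1.
Proof.
move=> z1 z2; rewrite /two_poles.
apply: (@derivableD _ _ _ ((fun x => g.[x] + a1 / (x - b1)) : C^o -> C^o)
          ((fun x => a2 / (x - b2)) : C^o -> C^o)); last exact: derivable_pole.
apply: (@derivableD _ _ _ (horner g : C^o -> C^o) ((fun x => a1 / (x - b1)) : C^o -> C^o)).
  exact: derivable_poly.
exact: derivable_pole.
Qed.

Lemma two_polesC g a1 b1 a2 b2 : two_poles g a1 b1 a2 b2 = two_poles g a2 b2 a1 b1.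
Proof. by apply/funext => z; rewrite /two_poles addrAC. Qed.

Lemma residue_two_poles g a1 b1 a2 b2 : b1 != b2 ->
  meromorphic_residue (two_poles g a1 b1 a2 b2) b1 a1.
Proof.
move=> b12; exists 0%N, (fun=> a1), (two_poles g 0 b2 a2 b2); split=> //.
  have := near_neq (_ : b2 != b1); rewrite eq_sym => /(_ b12).
  by apply: filterS => z zb; exact: derivable_two_poles.
near=> z; rewrite big_ord1 /two_poles expr1 mul0r addr0.
by rewrite addrA (addrC (_ / _)).
Unshelve. all: by end_near. Qed.

Lemma meromorphic_two_poles g a1 b1 a2 b2 b : b1 != b2 ->
  exists s, meromorphic_residue (two_poles g a1 b1 a2 b2) b s.
Proof.
move=> b12.
have [->|bb1] := eqVneq b b1; first by exists a1; exact: residue_two_poles.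
have [->|bb2] := eqVneq b b2.
  by exists a2; rewrite two_polesC; apply: residue_two_poles; rewrite eq_sym.
exists 0, 0%N, (fun=> 0), (two_poles g a1 b1 a2 b2); split=> //.
  rewrite eq_sym in bb1; rewrite eq_sym in bb2.
  near=> z; apply: derivable_two_poles; near: z; exact: near_neq.
by near=> z; rewrite big_ord1 mul0r add0r.
Unshelve. all: by end_near. Qed.

Lemma poly_series g z : series (fun n => g`_n * z ^+ n) n @[n --> \oo] --> g.[z].
Proof.
apply: cvg_near_cst; near=> n.
have sn : (size g <= n)%N by near: n; exact: nbhs_infty_ge.
rewrite /series /= big_mkord; exact/esym/horner_coef_wide.
Unshelve. all: by end_near. Qed.

End SimplePoles.

Section Archimedean.
Import numFieldNormedType.Exports.
Local Open Scope classical_set_scope.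
Variable C : numClosedFieldType.
Hypothesis small_pow : forall e : C, 0 < e -> \forall n \near \oo, (2^-1 : C) ^+ n < e.

(** The half disc replaces the unit disc because only powers of [1/2] are assumed to be
    small. *)
Lemma cvg_geometric_series_half_disc (w : C) : `|w| <= 2^-1 ->
  series (fun n => w ^+ n) n @[n --> \oo] --> (1 - w)^-1.
Proof.
move=> w2.
have w1 : `|w| < 1 by apply: le_lt_trans w2 _; rewrite invf_lt1 ?ltr1n.
have w0 : 1 - w != 0.
  by rewrite subr_eq0; apply: contraTneq w1 => <-; rewrite normr1 ltxx.
have -> : series (fun n => w ^+ n) = (fun n => (1 - w ^+ n) * (1 - w)^-1).
  apply/funext => n; rewrite /series /= big_mkord; apply: (canRL (mulfK w0)).
  rewrite mulrC -[1 in RHS](expr1n _ n) subrXX; congr (_ * _).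
  by apply: eq_bigr => i _; rewrite expr1n mul1r.
rewrite -[X in _ --> X]mul1r -[X in X * _]subr0.
apply: (@cvgM C); last exact: cvg_cst.
apply: (@cvgB _ C^o); first exact: cvg_cst.
apply/(@cvgr0Pnorm_lt _ C^o) => e e0.
apply: filterS (small_pow e0) => n; apply: le_lt_trans.
by rewrite normrX lerXn2r // nnegrE.
Qed.

(** The sum of the series near [0] is [g + u / (1 - z) + v / (1 - q z)], which is
    meromorphic on the whole plane; rewriting [u / (1 - z)] as [- u / (z - 1)] and
    [v / (1 - q z)] as [- (v / q) / (z - 1/q)] exhibits the residues. *)
Lemma fps_residue_simple_poles (f : fps int) (g : {poly C}) (u v q : C) :
  1 < q -> (forall n, (fps_coef f n)%:~R = g`_n + u + v * q ^+ n) ->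
  fps_residue f q^-1 (- (v / q)) /\ fps_residue f 1 (- u).
Proof.
move=> q1 fE.
have q0 : 0 < q := lt_trans ltr01 q1.
have qi1 : q^-1 < 1 by rewrite invf_lt1.
have qn1 : q^-1 != 1 by rewrite lt_eqF.
pose Fz := two_poles g (- (v / q)) q^-1 (- u) 1.
have mer b : exists s, meromorphic_residue Fz b s by exact: meromorphic_two_poles.
have ser : \forall z \near (0 : C),
    series (fun n => (fps_coef f n)%:~R * z ^+ n) n @[n --> \oo] --> Fz z.
  have e0 : 0 < (2 * q)^-1 by rewrite invr_gt0 mulr_gt0.
  near=> z.
  have zs : `|z| < (2 * q)^-1.
    by rewrite -normrN -sub0r; near: z; apply: (@cvgr_dist_lt _ C^o).
  have qz2 : `|q * z| <= 2^-1.
    rewrite normrM gtr0_norm // mulrC -ler_pdivlMr // -invfM; exact: ltW.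
  have z2 : `|z| <= 2^-1.
    apply: le_trans qz2; rewrite normrM gtr0_norm // ler_peMl //; exact: ltW.
  have -> : series (fun n => (fps_coef f n)%:~R * z ^+ n) =
     series (fun n => g`_n * z ^+ n) \+
     (cst u \* series (fun n => z ^+ n)) \+ (cst v \* series (fun n => (q * z) ^+ n)).
    apply/funext => n; rewrite /series /= !mulr_sumr -!big_split /=.
    by apply: eq_bigr => i _; rewrite fE exprMn !mulrDl mulrA.
  have -> : Fz z = g.[z] + u * (1 - z)^-1 + v * (1 - q * z)^-1.
    have q0' : q != 0 by rewrite gt_eqF.
    rewrite /Fz /two_poles addrAC; congr (_ + _ + _).
      by rewrite -[z - 1]opprB invrN mulrNN.
    have -> : z - q^-1 = - (q^-1 * (1 - q * z)).
      by rewrite mulrBr mulr1 mulrA mulVf // mul1r opprB.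
    by rewrite invrN mulrNN invfM invrK mulrA divfK.
  apply: (@cvgD _ C^o); last first.
    by apply: (@cvgM C); [exact: cvg_cst|exact: cvg_geometric_series_half_disc].
  apply: (@cvgD _ C^o); first exact: poly_series.
  by apply: (@cvgM C); [exact: cvg_cst|exact: cvg_geometric_series_half_disc].
(* The disc of radius 2 contains 1 and 1/q. *)
split; exists 2, Fz; split=> //.
- by rewrite ger0_norm ?invr_ge0 ?ltW // (lt_trans qi1) // ltr1n.
- exact: residue_two_poles.
- by rewrite normr1 ltr1n.
- by rewrite /Fz two_polesC; apply: residue_two_poles; rewrite eq_sym.
Unshelve. all: by end_near. Qed.

End Archimedean.

Section ComplexNumbers.
Import numFieldNormedType.Exports.
Local Open Scope classical_set_scope.

(** Powers of [1/2] tend to [0] in [R[i]] because a positive complex number is real and [R]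
    is archimedean. *)
Lemma complex_small_pow (R : realType) (e : R[i]) : 0 < e ->
  \forall n \near \oo, (2^-1 : R[i]) ^+ n < e.
Proof.
case: e => r i; rewrite ltcE /= => /andP[/eqP i0 r0]; rewrite {}i0.
have : (fun n => (2^-1 : R) ^+ n) @ \oo --> (0 : R).
  by apply: cvg_expr; rewrite ger0_norm ?invf_lt1 ?ltr1n.
move/cvgr0Pnorm_lt/(_ r r0); apply: filterS => n.
rewrite ger0_norm ?exprn_ge0 // -ltcR rmorphXn /= => H.
by apply: le_lt_trans H; rewrite fmorphV rmorph_nat.
Qed.

End ComplexNumbers.

(** * Polynomials with constant term 1 and partial fractions *)

Section RationalZeta.
Variable C : numClosedFieldType.

Lemma fps_theta_euler_poly d (omega : 'I_d -> C) :
  fps_theta (poly_fps (\prod_(j < d) (1 - omega j *: 'X))) =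
  poly_fps (\prod_(j < d) (1 - omega j *: 'X)) * \sum_(j < d) (1 - fps_geom (omega j)).
Proof.
have -> : poly_fps (\prod_(j < d) (1 - omega j *: 'X)) =
    \prod_(j < d) poly_fps (1 - omega j *: 'X).
  by apply: big_morph; [exact: poly_fpsM|exact: poly_fps1].
by apply: fps_theta_prod => j; exact: fps_theta_linear.
Qed.

Lemma euler_poly_coef0 d (omega : 'I_d -> C) :
  (\prod_(j < d) (1 - omega j *: 'X))`_0 = 1.
Proof.
by rewrite -horner_coef0 horner_prod big1 // => j _; rewrite !hornerE /= ?mulr0 ?subr0.
Qed.

Lemma size_euler_factor (w : C) : w != 0 -> size (1 - w *: 'X) = 2%N.
Proof.
move=> w0; rewrite addrC size_polyDl size_polyN ?size_scale ?size_polyX ?size_poly1 //.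
Qed.

Lemma size_euler_poly d (omega : 'I_d -> C) : (forall j, omega j != 0) ->
  size (\prod_(j < d) (1 - omega j *: 'X)) = d.+1.
Proof.
move=> w0; rewrite size_prod => [|j _]; last first.
  by rewrite -size_poly_eq0 size_euler_factor.
rewrite (eq_bigr (fun=> 2%N)) => [|j _]; last by rewrite size_euler_factor.
by rewrite sum_nat_const card_ord muln2 -addnn -addSn addnK.
Qed.

(** Over a closed field, a polynomial with constant term [1] has only nonzero roots, and
    [X - r = - r (1 - X / r)]; the leading scalars then multiply to the constant term. *)
Lemma euler_factorization (p : {poly C}) : p`_0 = 1 ->
  exists omega : 'I_(size p).-1 -> C, (forall j, omega j != 0) /\
    p = \prod_(j < (size p).-1) (1 - omega j *: 'X).
Proof.
move=> p0; have [rs Ep] := closed_field_poly_normal p.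
have pn0 : p != 0 by apply: contra_eq_neq p0 => ->; rewrite coef0 eq_sym oner_eq0.
have szp : (size p).-1 = size rs.
  by rewrite Ep size_scale ?lead_coef_eq0 // size_prod_XsubC.
have r0 r : r \in rs -> r != 0.
  apply: contraTneq => ->; rewrite -root_prod_XsubC.
  rewrite -(rootZ _ _ (_ : lead_coef p != 0)) ?lead_coef_eq0 //.
  by rewrite -Ep /root horner_coef0 p0 oner_eq0.
rewrite szp; exists (fun j => (tnth (in_tuple rs) j)^-1); split.
  by move=> j; rewrite invr_eq0 r0 // mem_tnth.
pose c := lead_coef p * \prod_(r <- rs) - r.
have Ep' : p = c *: \prod_(r <- rs) (1 - r^-1 *: 'X).
  rewrite {1}Ep /c -scalerA; congr (_ *: _).
  elim: (rs) r0 => [|r s IH] r0; first by rewrite !big_nil scale1r.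
  rewrite !big_cons IH => [|x xs]; last by apply: r0; rewrite inE xs orbT.
  have -> : 'X - r%:P = (- r) *: (1 - r^-1 *: 'X).
    rewrite scalerBr scalerA mulNr divff ?r0 ?mem_head // scaleN1r opprK.
    by rewrite scaleNr alg_polyC addrC.
  by rewrite -scalerAl -scalerAr scalerA.
have c1 : c = 1.
  move: p0; rewrite {1}Ep' coefZ -horner_coef0 horner_prod big1 ?mulr1 // => r _.
  by rewrite !hornerE /= ?mulr0 ?subr0.
by rewrite Ep' c1 scale1r big_tnth.
Qed.

(** The coefficients are forced by evaluation at [1] and [1/q]; with them, the
    difference vanishes at both points and is divisible by [(1 - X) (1 - q X)].
    The factor [1 - 1 *: 'X] has the shape of an Euler factor with reciprocal root [1]. *)
Lemma partial_fractions (q : C) (p : {poly C}) : q != 0 -> q != 1 ->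
  exists g : {poly C}, p = (1 - 1 *: 'X) * (1 - q *: 'X) * g
    + (p.[1] / (1 - q)) *: (1 - q *: 'X) + (p.[q^-1] / (1 - q^-1)) *: (1 - 1 *: 'X).
Proof.
move=> q0 q1.
set u := p.[1] / _; set v := p.[q^-1] / _.
have q1' : 1 - q != 0 by rewrite subr_eq0 eq_sym.
have qi1 : 1 - q^-1 != 0 by rewrite subr_eq0 eq_sym invr_eq1.
pose r := p - u *: (1 - q *: 'X) - v *: (1 - 1 *: 'X).
have r1 : root r 1.
  by rewrite /root /r !hornerE /= ?mulr1 subrr ?mulr0 subr0 /u divfK // subrr.
have : root r q^-1.
  by rewrite /root /r !hornerE /= divff // subrr ?mulr0 subr0 /v ?mul1r divfK // subrr.
have [h Eh] := factor_theorem _ _ r1.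
rewrite Eh rootM root_XsubC (negPf (_ : q^-1 != 1)) ?invr_eq1 // orbF.
move=> /factor_theorem[g Eg]; exists (q^-1 *: g).
have -> : p = r + u *: (1 - q *: 'X) + v *: (1 - 1 *: 'X).
  by rewrite /r addrAC !subrK.
congr (_ + _ + _); rewrite Eh Eg scale1r.
have -> : 1 - q *: 'X = - (q *: ('X - q^-1%:P)).
  by rewrite scalerBr -alg_polyC scalerA divff // scale1r opprB.
have e : - (q *: ('X - q^-1%:P)) * (q^-1 *: g) = - (('X - q^-1%:P) * g).
  by rewrite mulNr -scalerAl -scalerAr scalerA divff // scale1r.
by rewrite -mulrA e polyC1; ring.
Qed.

(** Two consecutive values of [a q^n + b] determine [a] and [b], because [q^n] takes
    distinct values there. *)
Lemma exp_affine_uniq (q a b c d : C) n : q != 0 -> q != 1 ->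
  a * q ^+ n + b = c * q ^+ n + d -> a * q ^+ n.+1 + b = c * q ^+ n.+1 + d ->
  a = c /\ b = d.
Proof.
move=> q0 q1 e1 e2.
have ac : a = c.
  apply/eqP; rewrite -subr_eq0; have : (a - c) * (q ^+ n * (q - 1)) = 0.
    rewrite exprS in e2.
    have -> : (a - c) * (q ^+ n * (q - 1)) =
      (a * (q * q ^+ n) + b - (a * q ^+ n + b))
      - (c * (q * q ^+ n) + d - (c * q ^+ n + d)) by ring.
    by rewrite e1 e2 subrr.
  by move/eqP; rewrite !mulf_eq0 expf_eq0 (negPf q0) andbF !subr_eq0 (negPf q1) !orbF.
by split=> //; move: e1; rewrite ac => /addrI.
Qed.

End RationalZeta.

(** * The three conditions *)

Section Equivalence.
Variables (F : finFieldType) (Fbar : closedFieldType).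
Variable iota : {rmorphism F -> Fbar}.
Hypothesis Fbar_algebraic : integralRange iota.
Variable M : gset (absGal iota).
Hypothesis M_lf : locally_finite M.
Local Notation phi := (Frobenius iota).
Local Notation Q := #|F|.
Local Notation euler1 := (poly_fps (1 - 1 *: 'X : {poly int})).
Local Notation eulerq := (poly_fps (1 - Q%:R *: 'X : {poly int})).

Let P1_lf := P1_locally_finite Fbar_algebraic.

(** The factors [1 - t] and [1 - q t] subtract [1 + q^r], the number of rational points
    of the projective line, from the number of rational points of [N]. *)
Lemma fps_theta_zeta_mul (N : gset (absGal iota)) (N_lf : locally_finite N) :
  fps_theta (euler1 * (eulerq * zeta N)) = euler1 * (eulerq * zeta N) *
    (rational_series N - rational_series (P1 iota)).
Proof.
have -> : rational_series N - rational_series (P1 iota) =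
   (1 - fps_geom 1) + (1 - fps_geom Q%:R) + rational_series N.
  rewrite addrC; congr (_ + _); apply: fpsP => -[|r] /=.
    by rewrite !subrr ?subr0 ?addr0 ?oppr0 ?expr0 ?subrr ?addr0.
  rewrite /num_rational (ncard_fixed_points_P1 iota (ltn0Sn r)).2 -addn1 natrD natrX.
  by rewrite !sub0r expr1n opprD addrC.
rewrite !fps_thetaM !fps_theta_linear (fps_theta_zeta Fbar_algebraic N_lf); ring.
Qed.

(** For the projective line itself the logarithmic derivative of the product vanishes, so
    the product is constant. *)
Lemma zeta_P1 : euler1 * (eulerq * zeta (P1 iota)) = 1.
Proof.
apply: (@fps_theta_uniq int _ _ 0) => //.
- rewrite !fps_coefM0 zeta_coef0 // !mulr1 /=.
  by rewrite !coefD !coefN !coefZ !coefX !coef1 !mulr0 subr0 mulr1.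
- by rewrite fps_theta_zeta_mul // subrr.
- by rewrite fps_theta1 mulr0.
Qed.

Definition zeta_ratio : fps int := zeta M / zeta (P1 iota).

Lemma zeta_ratioE : zeta_ratio = euler1 * (eulerq * zeta M).
Proof.
have u : zeta (P1 iota) \is a GRing.unit.
  by rewrite fps_unitE zeta_coef0.
rewrite /zeta_ratio -[zeta M in LHS]mul1r -zeta_P1.
apply: (mulIr u); rewrite divrK //; ring.
Qed.

Lemma fps_theta_zeta_ratio :
  fps_theta zeta_ratio = zeta_ratio * (rational_series M - rational_series (P1 iota)).
Proof. by rewrite zeta_ratioE fps_theta_zeta_mul. Qed.

Lemma zeta_ratio_coef0 : fps_coef zeta_ratio 0 = 1.
Proof.
rewrite zeta_ratioE !fps_coefM0 zeta_coef0 // !mulr1 /=.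
by rewrite !coefD !coefN !coefZ !coefX !coef1 !mulr0 subr0 mulr1.
Qed.

Variable C : numClosedFieldType.
Local Notation toC := (intr : {rmorphism int -> C}).
Local Notation mapC := (fps_map toC).
Local Notation q := (Q%:R : C).

Definition fixed_point_formula (d : nat) (omega : 'I_d -> C) :=
  (forall j, omega j != 0) /\
  (forall r : nat, (0 < r)%N ->
     (num_rational (P1 iota) r)%:R - (num_rational M r)%:R
       = \sum_(j < d) omega j ^+ r).

(** The fixed point formula says that [zeta_ratio] and [prod_j (1 - omega_j t)] have
    the same logarithmic derivative. *)
Lemma fixed_point_formulaE d (omega : 'I_d -> C) :
  (forall r : nat, (0 < r)%N ->
     (num_rational (P1 iota) r)%:R - (num_rational M r)%:R
       = \sum_(j < d) omega j ^+ r) <->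
  mapC (rational_series M - rational_series (P1 iota)) =
    \sum_(j < d) (1 - fps_geom (omega j)).
Proof.
have coefE r : fps_coef (\sum_(j < d) (1 - fps_geom (omega j))) r.+1
    = - \sum_(j < d) omega j ^+ r.+1.
  rewrite fps_coef_sum -sumrN; apply: eq_bigr => j _.
  by rewrite fps_coefD fps_coefN /= sub0r.
have mapE r : fps_coef (mapC (rational_series M - rational_series (P1 iota))) r.+1
    = (num_rational M r.+1)%:R - (num_rational (P1 iota) r.+1)%:R.
  by rewrite /= rmorphB /= !rmorph_nat.
split=> [H|H [//|r] _].
  apply: fpsP => -[|r]; last by rewrite coefE mapE -H // opprB.
  rewrite fps_coef_sum big1 => [|j _]; first by rewrite /= subrr.
  by rewrite fps_coefD fps_coefN /= subrr.
by rewrite -[RHS]opprK -coefE -H mapE opprB.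
Qed.

(** Two series with constant term [1] and the same logarithmic derivative agree, so the
    image of [zeta_ratio] in complex power series is the product; its
    coefficients being integers, it comes from an integer polynomial. *)
Lemma poly_of_fixed_points d (omega : 'I_d -> C) : fixed_point_formula omega ->
  exists p : {poly int}, [/\ zeta_ratio = poly_fps p, size p = d.+1 &
    map_poly intr p = \prod_(j < d) (1 - omega j *: 'X)].
Proof.
move=> [w0 /fixed_point_formulaE H].
have E : mapC zeta_ratio = poly_fps (\prod_(j < d) (1 - omega j *: 'X)).
  apply: (@fps_theta_uniq C _ _ (\sum_(j < d) (1 - fps_geom (omega j)))).
  - rewrite fps_coef_sum big1 // => j _.
    by rewrite fps_coefD fps_coefN /= subrr.
  - rewrite [RHS]euler_poly_coef0; change (toC (fps_coef zeta_ratio 0) = 1).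
    by rewrite zeta_ratio_coef0.
  - by rewrite -fps_map_theta fps_theta_zeta_ratio fps_mapM H.
  - exact: fps_theta_euler_poly.
have PE : zeta_ratio = poly_fps (\poly_(i < d.+1) fps_coef zeta_ratio i).
  apply: poly_fps_trunc => i di; apply: (@intr_inj C).
  have /(congr1 (@fps_coef C ^~ i)) /= -> := E.
  by rewrite nth_default // size_euler_poly.
exists (\poly_(i < d.+1) fps_coef zeta_ratio i).
have mE : map_poly intr (\poly_(i < d.+1) fps_coef zeta_ratio i) =
    \prod_(j < d) (1 - omega j *: 'X).
  by apply: poly_fps_inj; rewrite -E [in RHS]PE fps_map_poly.
split=> //; rewrite -[RHS](size_euler_poly w0) -mE size_map_inj_poly //.
exact: (@intr_inj C).
Qed.

(** The factorization into linear factors computes the logarithmic derivative a second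
    time; comparing the two gives the formula. *)
Lemma fixed_points_of_poly (p : {poly int}) : zeta_ratio = poly_fps p ->
  exists omega : 'I_(size p).-1 -> C, fixed_point_formula omega.
Proof.
move=> E; have p0 : (map_poly toC p)`_0 = 1.
  by rewrite coef_map; have := zeta_ratio_coef0; rewrite E /= => ->.
have szp : size (map_poly toC p) = size p.
  by rewrite size_map_inj_poly //; exact: (@intr_inj C).
have [omega [w0 pE]] := euler_factorization p0; rewrite szp in omega w0 pE.
exists omega; split=> //; apply/fixed_point_formulaE.
have u : mapC zeta_ratio \is a GRing.unit.
  rewrite fps_unitE; change (toC (fps_coef zeta_ratio 0) \is a GRing.unit).
  by rewrite zeta_ratio_coef0 rmorph1 unitr1.
apply: (mulrI u); rewrite -fps_mapM -fps_theta_zeta_ratio fps_map_theta E fps_map_poly pE.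
exact: fps_theta_euler_poly.
Qed.

Let q_gt1 : 1 < q.
Proof. by rewrite ltr1n; exact: card_finField_gt1. Qed.
Let q_neq0 : q != 0.
Proof. by rewrite gt_eqF // (lt_trans ltr01). Qed.
Let q_neq1 : q != 1.
Proof. by rewrite gt_eqF. Qed.

Lemma num_effectiveC n : (num_effective M n)%:R = toC (fps_coef (zeta M) n).
Proof. by rewrite -num_effectiveE // rmorph_nat. Qed.

(** Dividing the partial fraction decomposition by [(1 - t) (1 - q t)] turns the two
    fractions into geometric series. *)
Lemma num_effective_poly (p : {poly int}) : zeta_ratio = poly_fps p ->
  exists g : {poly C}, forall n, (num_effective M n)%:R =
    g`_n + (map_poly toC p).[1] / (1 - q)
      + (map_poly toC p).[q^-1] / (1 - q^-1) * q ^+ n.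
Proof.
move=> E; set pC := map_poly toC p.
have [g] := partial_fractions pC q_neq0 q_neq1.
set u := pC.[1] / _; set v := pC.[q^-1] / _ => gE.
exists g => n; rewrite num_effectiveC.
have [G1 Gq] := (fps_geomP (1 : C), fps_geomP q).
suff -> : toC (fps_coef (zeta M) n) = fps_coef
    (poly_fps g + poly_fps u%:P * fps_geom 1 + poly_fps v%:P * fps_geom q) n.
  have cE (w : C) : poly_fps w%:P = fps_const w.
    by apply: fpsP => -[|i]; rewrite /= coefC.
  by rewrite !fps_coefD !cE !fps_coef_constM /= expr1n mulr1.
rewrite -[LHS]/(fps_coef (mapC (zeta M)) n); congr (fps_coef _ n).
have mE (x : int) : mapC (poly_fps (1 - x *: 'X)) = poly_fps (1 - toC x *: 'X).
  by rewrite fps_map_poly rmorphB rmorph1 /= map_polyZ map_polyX.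
have := congr1 mapC E.
rewrite zeta_ratioE !fps_mapM !mE fps_map_poly -/pC rmorph1 rmorph_nat.
set e1 := poly_fps (1 - _) in G1 *; set eq := poly_fps (1 - _) in Gq *.
have -> : poly_fps pC = e1 * eq * poly_fps g + poly_fps u%:P * eq + poly_fps v%:P * e1.
  by rewrite -!poly_fpsM -!poly_fpsD !mul_polyC -gE.
move=> H; transitivity ((e1 * fps_geom 1) * (eq * fps_geom q) * mapC (zeta M)).
  by rewrite G1 Gq !mul1r.
transitivity (fps_geom 1 * fps_geom q * (e1 * (eq * mapC (zeta M)))); first by ring.
rewrite H.
transitivity ((e1 * fps_geom 1) * (eq * fps_geom q) * poly_fps g
   + poly_fps u%:P * fps_geom 1 * (eq * fps_geom q)
   + poly_fps v%:P * fps_geom q * (e1 * fps_geom 1)); first by ring.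
by rewrite G1 Gq !mul1r !mulr1.
Qed.

Lemma num_effective_eventually (p : {poly int}) : zeta_ratio = poly_fps p ->
  exists N, forall n, (N <= n)%N -> (num_effective M n)%:R =
    (map_poly toC p).[q^-1] / (1 - q^-1) * q ^+ n + (map_poly toC p).[1] / (1 - q).
Proof.
move=> /num_effective_poly[g gE]; exists (size g) => n ng.
by rewrite gE nth_default // add0r addrC.
Qed.

(** Both [q^n] and the constants are killed by the recurrence with characteristic
    polynomial [(1 - t) (1 - q t)]. *)
Lemma zeta_ratio_poly_of_RR (r1 r2 : C) n0 :
  (forall n, (n0 <= n)%N -> (num_effective M n)%:R = - q ^+ n.+1 * r1 - r2) ->
  exists p : {poly int}, zeta_ratio = poly_fps p.
Proof.
move=> H; exists (\poly_(i < n0.+2) fps_coef zeta_ratio i).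
apply: poly_fps_trunc => -[|[|n]] // n0n.
rewrite zeta_ratioE !fps_coef_linearM mul1r.
apply: (@intr_inj C); rewrite !rmorphB !rmorphM /= rmorph_nat -!num_effectiveC.
by rewrite !H ?(leqW n0n) // ?leqW // !exprS; ring.
Qed.

(** The two descriptions of the number of effective divisors for large [n] identify [r1]
    and [r2], hence the equality for every [n]. *)
Lemma RR_values (r1 r2 : C) n0 (p : {poly int}) : zeta_ratio = poly_fps p ->
  (forall n, (n0 <= n)%N -> (num_effective M n)%:R = - q ^+ n.+1 * r1 - r2) ->
  forall n, - q ^+ n.+1 * r1 - r2
    = (q ^+ n.+1 * (map_poly toC p).[q^-1] - (map_poly toC p).[1]) / (q - 1).
Proof.
move=> /num_effective_eventually[N NE] H n.
set v := (map_poly toC p).[q^-1] in NE *; set u := (map_poly toC p).[1] in NE *.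
pose m := maxn n0 N.
have HE k : - q ^+ k.+1 * r1 - r2 = (- (q * r1)) * q ^+ k + - r2 by rewrite exprS; ring.
have [] := @exp_affine_uniq C q (- (q * r1)) (- r2) (v / (1 - q^-1)) (u / (1 - q)) m
  q_neq0 q_neq1.
- by rewrite -HE -H ?leq_maxl // NE ?leq_maxr.
- by rewrite -HE -H ?leqW ?leq_maxl // NE ?leqW ?leq_maxr.
move=> rv ru; rewrite HE rv ru exprS; field.
by rewrite q_neq0 subr_eq0 q_neq1 subr_eq0 eq_sym q_neq1.
Qed.

(** Beyond the degree of the polynomial part [g], only the two geometric series coming from
    the poles contribute to the coefficients. *)
Lemma generic_RR_of_poly (p : {poly int}) :
  (forall e : C, 0 < e -> (\forall n \near \oo, (2^-1 : C) ^+ n < e)%classic) ->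
  zeta_ratio = poly_fps p -> generic_RR M q.
Proof.
move=> small /num_effective_poly[g]; set u := _ / (1 - q); set v := _ / (1 - q^-1) => gE.
exists (- (v / q)), (- u), (size g).
have [|res1 res2] := @fps_residue_simple_poles C small (zeta M) g u v q q_gt1.
  by move=> n; rewrite -gE num_effectiveC.
split=> // n ng; rewrite gE nth_default // exprS; field; exact: q_neq0.
Qed.

End Equivalence.

Theorem proposition10 (F : finFieldType) (Fbar : closedFieldType)
    (iota : {rmorphism F -> Fbar}) (Fbar_algebraic : integralRange iota)
    (M : gset (absGal iota)) (M_locally_finite : locally_finite M)
    (R : realType) :
  let q : R[i] := #|F|%:R in
  let P_M : fps int := zeta M / zeta (P1 iota) in
  let num_rational (X : gset (absGal iota)) (r : nat) :=
    ncard (fixed_points X (Frobenius iota ^+ r)%g) in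
  let fixed_point_formula (d : nat) (omega : 'I_d -> R[i]) :=
    (forall j, omega j != 0) /\
    (forall r : nat, (0 < r)%N ->
       (num_rational (P1 iota) r)%:R - (num_rational M r)%:R
         = \sum_(j < d) omega j ^+ r) in
  [/\ [<-> exists d delta : nat, (d <= delta)%N /\
             exists p : {poly int}, P_M = poly_fps p /\ size p = d.+1;
           generic_RR M q;
           exists (d : nat) (omega : 'I_d -> R[i]),
             fixed_point_formula d omega],
      forall (r1 r2 : R[i]) (n0 : nat), generic_RR_from M q r1 r2 n0 ->
        exists p : {poly int}, P_M = poly_fps p /\
          forall n : nat, (n0 <= n)%N ->
            - q ^+ n.+1 * r1 - r2
              = (q ^+ n.+1 * (map_poly intr p).[q^-1] - (map_poly intr p).[1])
                  / (q - 1) &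
      forall (d : nat) (omega : 'I_d -> R[i]),
        fixed_point_formula d omega ->
        exists p : {poly int}, [/\ P_M = poly_fps p, size p = d.+1 &
          map_poly intr p = \prod_(j < d) (1 - omega j *: 'X)]].
Proof.
move=> q P_M num_rat fpf.
have toP (r1 r2 : R[i]) n0 : generic_RR_from M q r1 r2 n0 ->
    exists p : {poly int}, P_M = poly_fps p.
  by case=> _ _ /(zeta_ratio_poly_of_RR Fbar_algebraic M_locally_finite).
have small : forall e : R[i], 0 < e -> (\forall n \near \oo, (2^-1 : R[i]) ^+ n < e)%classic.
  exact: complex_small_pow.
split.
- tfae.
  + case=> d [delta [_ [p [E _]]]].
    exact: (generic_RR_of_poly Fbar_algebraic M_locally_finite small E).
  + case=> r1 [r2 [n0 /toP[p E]]]; exists (size p).-1.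
    exact: (fixed_points_of_poly Fbar_algebraic M_locally_finite _ E).
  + case=> d [omega /(poly_of_fixed_points Fbar_algebraic M_locally_finite)[p [E sp _]]].
    by exists d, d; split=> //; exists p.
- move=> r1 r2 n0 RR; have [p E] := toP _ _ _ RR; exists p; split=> // n _.
  case: RR => _ _ H.
  exact: (RR_values Fbar_algebraic M_locally_finite E H).
- move=> d omega; exact: (poly_of_fixed_points Fbar_algebraic M_locally_finite).
Qed.
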